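(* For any integers $m\geq k\geq 1$, the 1-morphism $M_k$ of the finitary 2-category $\mathscr{D}^{(m)}$ is great for the left cell $\mathcal{L}=\{N_k,M_k\}$.
   Context: Let $\Bbbk$ be an algebraically closed field of characteristic $0$ and $D=\Bbbk[x]/(x^2)$. Fix a small category $\mathcal{C}$ equivalent to the category $D$-mod of finite dimensional left $D$-modules. The 2-category $\mathscr{D}$ has one object $\mathtt{i}$ (identified with $\mathcal{C}$); its 1-morphisms are all endofunctors of $\mathcal{C}$ isomorphic to tensoring $U\otimes_D-$ with a finite dimensional $D$-$D$-bimodule $U$; its 2-morphisms are all natural transformations (i.e. bimodule homomorphisms). Composition of 1-morphisms is $\otimes_D$, the identity $\mathbbm{1}_{\mathtt{i}}$ corresponds to ${}_DD_D$, and bimodules and the corresponding 1-morphisms are denoted by the same symbols. String bimodules, $k\geq 0$: $M_k$ has basis $m_1,\dots,m_{2k+3}$ with $m_{2j}x=m_{2j-1}$, $xm_{2j}=m_{2j+1}$ for $1\leq j\leq k+1$, and $x$ annihilates all $m_{i}$ with $i$ odd from both sides; $N_k=M_k/\mathrm{span}\{m_{2k+3}\}$, $S_k=M_k/\mathrm{span}\{m_1\}$, $W_k=M_k/\mathrm{span}\{m_1,m_{2k+3}\}$. The remaining indecomposable bimodules are $D\otimes_\Bbbk D$ and the band bimodules (including ${}_DD_D$). For indecomposable 1-morphisms (up to isomorphism) write $F\leq_L G$ if $G$ is a direct summand of $H\circ F$ for some $H$, and $F\leq_J G$ if $G$ is a direct summand of $H_1\circ F\circ H_2$ for some $H_1,H_2$;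 left and two-sided cells are the corresponding equivalence classes. The two-sided cells of $\mathscr{D}$ are $\mathcal{J}_{\Bbbk\text{-split}}=\{D\otimes_\Bbbk D,W_0,S_0,N_0\}$, $\mathcal{J}_0=\{M_0\}$, $\mathcal{J}_k=\{W_k,S_k,N_k,M_k\}$ for $k\geq1$, and $\mathcal{J}_{\mathrm{band}}$ (all band bimodules), with $\mathcal{J}_{\Bbbk\text{-split}}>_J\mathcal{J}_0>_J\mathcal{J}_1>_J\mathcal{J}_2>_J\cdots>_J\mathcal{J}_{\mathrm{band}}$. The left cells in $\mathcal{J}_k$, $k\geq1$, are $\{W_k,S_k\}$ and $\{N_k,M_k\}$. For a positive integer $m$, $\mathscr{D}^{(m)}$ is the 2-full 2-subcategory of $\mathscr{D}$ given by the additive closure of all 1-morphisms in all two-sided cells $\mathcal{J}\geq_J\mathcal{J}_m$ together with $\mathbbm{1}_\mathtt{i}$. Let $\mathcal{L}$ be a left cell in a 2-category and $\mathtt{i}$ the object where its 1-morphisms start. A 1-morphism $G$ is good for $\mathcal{L}$ (via $\varphi$) if there is a 2-morphism $\varphi:G\to\mathbbm{1}_\mathtt{i}$ such that for every $F\in\mathcal{L}$ the 2-morphism $F\varphi:FG\to F$ is right split, i.e. there is $\xi:F\to FG$ with $F\varphi\circ_v\xi=\mathrm{id}_F$ ($\circ_v$ is vertical composition). $G$ is great for $\mathcal{L}$ if it is good for $\mathcal{L}$ via some $\varphi$ and, for any 1-morphism $G'$ (of the same 2-category) which is good for $\mathcal{L}$ via $\varphi':G'\to\mathbbm{1}_\mathtt{i}$,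 there is a 2-morphism $\beta:G\to G'$ with $\varphi=\varphi'\circ_v\beta$. *)

(* Defs.v *)
From HB Require Import structures.
From mathcomp Require Import all_boot all_algebra all_field.
From mathcomp Require Import boolp.

Set Implicit Arguments.
Unset Strict Implicit.
Unset Printing Implicit Defensive.
Import GRing.Theory VectorInternalTheory.
Local Open Scope ring_scope.

(* Categories, functors, natural transformations.  Natural transformations are
   compared componentwise ([nt_eq]). *)

Record category := Category {
  ob :> Type;
  hom : ob -> ob -> Type;
  idm : forall X, hom X X;
  comp : forall X Y Z, hom Y Z -> hom X Y -> hom X Z;
  comp1m : forall X Y (f : hom X Y), comp (idm Y) f = f;
  compm1 : forall X Y (f : hom X Y), comp f (idm X) = f;
  compA : forall X Y Z T (h : hom Z T) (g : hom Y Z) (f : hom X Y),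
    comp h (comp g f) = comp (comp h g) f
}.
Arguments hom {c} X Y.
Arguments idm {c} X.
Arguments comp {c X Y Z} g f.

Record functor (C D : category) := Functor {
  fob :> C -> D;
  fmap : forall X Y, hom X Y -> hom (fob X) (fob Y);
  fmap1 : forall X, fmap (idm X) = idm (fob X);
  fmapM : forall X Y Z (g : hom Y Z) (f : hom X Y),
    fmap (comp g f) = comp (fmap g) (fmap f)
}.
Arguments fmap {C D} _ {X Y} _.

Record nat_trans (C D : category) (F G : functor C D) := NatTrans {
  nt :> forall X : C, hom (F X) (G X);
  ntP : forall (X Y : C) (f : hom X Y),
    comp (nt Y) (fmap F f) = comp (fmap G f) (nt X)
}.

Definition nt_eq (C D : category) (F G : functor C D) (a b : nat_trans F G) :=
  forall X, a X = b X.

Definition idF (C : category) : functor C C :=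
  @Functor C C id (fun _ _ f => f) (fun _ => erefl) (fun _ _ _ _ _ => erefl).

Section Composition.
Variables C D E : category.

Lemma compF_id (F : functor D E) (G : functor C D) (X : C) :
  fmap F (fmap G (idm X)) = idm (F (G X)).
Proof. by rewrite !fmap1. Qed.

Lemma compF_comp (F : functor D E) (G : functor C D) (X Y Z : C)
    (g : hom Y Z) (f : hom X Y) :
  fmap F (fmap G (comp g f)) = comp (fmap F (fmap G g)) (fmap F (fmap G f)).
Proof. by rewrite !fmapM. Qed.

Definition compF (F : functor D E) (G : functor C D) : functor C E :=
  Functor (fob := fun X => F (G X)) (fmap := fun X Y f => fmap F (fmap G f))
    (compF_id F G) (@compF_comp F G).

End Composition.

Section NatTrans.
Variables C D : category.

Lemma idN_nat (F : functor C D) (X Y : C) (f : hom X Y) :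
  comp (idm (F Y)) (fmap F f) = comp (fmap F f) (idm (F X)).
Proof. by rewrite comp1m compm1. Qed.

Definition idN (F : functor C D) : nat_trans F F :=
  NatTrans (nt := fun X => idm (F X)) (@idN_nat F).

Lemma vcomp_nat (F G H : functor C D) (b : nat_trans G H) (a : nat_trans F G)
    (X Y : C) (f : hom X Y) :
  comp (comp (b Y) (a Y)) (fmap F f) = comp (fmap H f) (comp (b X) (a X)).
Proof. by rewrite -compA ntP compA ntP compA. Qed.

Definition vcomp (F G H : functor C D) (b : nat_trans G H) (a : nat_trans F G) :
    nat_trans F H :=
  NatTrans (nt := fun X => comp (b X) (a X)) (@vcomp_nat _ _ _ b a).

Definition nat_iso (F G : functor C D) : Prop :=
  exists (a : nat_trans F G) (b : nat_trans G F),
    nt_eq (vcomp b a) (idN F) /\ nt_eq (vcomp a b) (idN G).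

End NatTrans.

Definition is_equivalence (C D : category) (E : functor C D) : Prop :=
  exists E' : functor D C,
    nat_iso (compF E' E) (idF C) /\ nat_iso (compF E E') (idF D).

Section Great.
Variable C : category.

Lemma whisker_nat (F G : functor C C) (phi : nat_trans G (idF C))
    (X Y : C) (f : hom X Y) :
  comp (fmap F (phi Y)) (fmap (compF F G) f) =
  comp (fmap F f) (fmap F (phi X)).
Proof. by rewrite /= -!fmapM (ntP phi f : comp _ _ = comp f _). Qed.

(* The whiskering [F phi : F G -> F], with [F 1] identified with [F]. *)
Definition whisker (F G : functor C C) (phi : nat_trans G (idF C)) :
    nat_trans (compF F G) F :=
  NatTrans (F := compF F G) (G := F) (nt := fun X => fmap F (phi X))
    (@whisker_nat F G phi).

Definition good_via (L : functor C C -> Prop) (G : functor C C)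
    (phi : nat_trans G (idF C)) : Prop :=
  forall F, L F -> exists xi : nat_trans F (compF F G),
    nt_eq (vcomp (whisker F phi) xi) (idN F).

(* [P] is the class of 1-morphisms of a 2-full 2-subcategory (with the single
   object [C]) of the 2-category of categories, functors and natural
   transformations; [L] is a class of 1-morphisms in [P]. *)
Definition great (P L : functor C C -> Prop) (G : functor C C) : Prop :=
  P G /\
  exists phi : nat_trans G (idF C), good_via L phi /\
    forall (G' : functor C C) (phi' : nat_trans G' (idF C)),
      P G' -> good_via L phi' ->
      exists beta : nat_trans G G', nt_eq phi (vcomp phi' beta).

End Great.

(* The quotient of a finite dimensional space [V] by a subspace [W], realized on
   the complement of [W]; [qproj W] is the projection, with kernel [W], and
   [qlift W] is a linear section of it. *)

Section Quotient.
Variables (K : fieldType) (V : vectType K) (W : {vspace V}).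

Definition quotv := subvs_of (W^C)%VS.
HB.instance Definition _ := Vector.on quotv.

Definition qproj (v : V) : quotv := vsproj (W^C)%VS (v - projv W v).
Definition qlift (t : quotv) : V := vsval t.

Lemma qproj_linear : linear qproj.
Proof.
move=> a u v; rewrite /qproj -linearP; congr vsproj.
by rewrite linearP scalerBr opprD addrACA.
Qed.
HB.instance Definition _ := GRing.isLinear.Build K V quotv _ qproj qproj_linear.

Lemma qlift_linear : linear qlift.
Proof. by move=> a u v; rewrite /qlift linearP. Qed.
HB.instance Definition _ := GRing.isLinear.Build K quotv V _ qlift qlift_linear.

Lemma qliftK : cancel qlift qproj.
Proof.
move=> t; rewrite /qproj /qlift.
suff -> : projv W (vsval t) = 0 by rewrite subr0 vsvalK.
by apply/eqP; rewrite -memv_ker lker_proj subvsP.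
Qed.

Lemma qprojK (v : V) : qlift (qproj v) - v \in W.
Proof.
rewrite /qproj /qlift vsprojK; last exact: memv_projC.
by rewrite addrC addKr memvN memv_proj.
Qed.

Lemma qproj_eq0 (v : V) : (qproj v == 0) = (v \in W).
Proof.
apply/eqP/idP=> [v0|vW].
  by have := qprojK v; rewrite v0 linear0 sub0r memvN.
by rewrite /qproj projv_id // subrr linear0.
Qed.

End Quotient.

Section QuotientMap.
Variables (K : fieldType) (V V' : vectType K).
Variables (W : {vspace V}) (W' : {vspace V'}).

(* The map of quotients induced by [g], meaningful when [g] maps [W] into
   [W']. *)
Definition qmap (g : V -> V') (t : quotv W) : quotv W' :=
  qproj W' (g (qlift t)).

Lemma qmap_linear (g : V -> V') : linear g -> linear (qmap g).
Proof. by move=> gl a u v; rewrite /qmap linearP gl linearP. Qed.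

Lemma qmapE (g : {linear V -> V'}) (v : V) :
  (forall w, w \in W -> g w \in W') -> qmap g (qproj W v) = qproj W' (g v).
Proof.
move=> gW; apply/eqP; rewrite -subr_eq0 /qmap -!linearB /= qproj_eq0.
exact/gW/qprojK.
Qed.

End QuotientMap.
Arguments qmap {K V V' W W'} g t.

Lemma qmap_comp (K : fieldType) (V V' V'' : vectType K) (W : {vspace V})
    (W' : {vspace V'}) (W'' : {vspace V''}) (g' : {linear V' -> V''})
    (g : V -> V') (t : quotv W) :
  (forall w, w \in W' -> g' w \in W'') ->
  qmap g' (qmap g t : quotv W') = qmap (g' \o g) t :> quotv W''.
Proof. by move=> gW; rewrite [qmap g t]/qmap qmapE. Qed.

Lemma eq_qmap (K : fieldType) (V V' : vectType K) (W : {vspace V})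
    (W' : {vspace V'}) (g g' : V -> V') (t : quotv W) :
  g =1 g' -> qmap g t = qmap g' t :> quotv W'.
Proof. by rewrite /qmap => ->. Qed.

(* The tensor product over K of two finite dimensional spaces, in
   coordinates. *)

Section TensorK.
Variable K : fieldType.

Definition tensK (U V : vectType K) : Type := 'M[K]_(dim U, dim V).
HB.instance Definition _ (U V : vectType K) := Vector.on (tensK U V).

Definition tens (U V : vectType K) (u : U) (v : V) : tensK U V :=
  (v2r u)^T *m v2r v.

Definition tmap (U U' V V' : vectType K) (f : U -> U') (g : V -> V')
    (t : tensK U V) : tensK U' V' :=
  (lin1_mx (v2r \o f \o r2v))^T *m t *m lin1_mx (v2r \o g \o r2v).

Lemma tmap_linear (U U' V V' : vectType K) (f : U -> U') (g : V -> V') :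
  linear (tmap f g).
Proof.
by move=> a s t; rewrite /tmap mulmxDr mulmxDl -scalemxAr -scalemxAl.
Qed.
HB.instance Definition _ (U U' V V' : vectType K) (f : U -> U') (g : V -> V') :=
  GRing.isLinear.Build K (tensK U V) (tensK U' V') _ (tmap f g)
    (tmap_linear f g).

Lemma tmapE (U U' V V' : vectType K) (f : {linear U -> U'})
    (g : {linear V -> V'}) (u : U) (v : V) :
  tmap f g (tens u v) = tens (f u) (g v).
Proof.
rewrite /tmap /tens mulmxA -trmx_mul -mulmxA.
by rewrite !mul_rV_lin1 /= !v2rK.
Qed.

Lemma tens_linl (U V : vectType K) (v : V) : linear (fun u : U => tens u v).
Proof.
by move=> a u u'; rewrite /tens linearP /= linearP /= mulmxDl -scalemxAl.
Qed.
Lemma tens_linr (U V : vectType K) (u : U) : linear (fun v : V => tens u v).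
Proof. by move=> a v v'; rewrite /tens linearP /= mulmxDr -scalemxAr. Qed.

Lemma eq_tmap (U U' V V' : vectType K) (f f' : U -> U') (g g' : V -> V') t :
  f =1 f' -> g =1 g' -> tmap f g t = tmap f' g' t.
Proof. by move=> /funext -> /funext ->. Qed.

Lemma tmap_id (U V : vectType K) (t : tensK U V) : tmap idfun idfun t = t.
Proof.
have e (Z : vectType K) : lin1_mx (v2r \o @idfun Z \o r2v) = 1%:M.
  by apply/row_matrixP=> i; rewrite !rowE mul_rV_lin1 mulmx1 /= r2vK.
by rewrite /tmap !e trmx1 mul1mx mulmx1.
Qed.

Lemma tmap_comp (U U' U'' V V' V'' : vectType K)
    (f' : {linear U' -> U''}) (f : {linear U -> U'})
    (g' : {linear V' -> V''}) (g : {linear V -> V'}) (t : tensK U V) :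
  tmap f' g' (tmap f g t) = tmap (f' \o f) (g' \o g) t.
Proof.
have e (X Y Z : vectType K) (h' : {linear Y -> Z}) (h : {linear X -> Y}) :
    lin1_mx (v2r \o (h' \o h) \o r2v) =
    lin1_mx (v2r \o h \o r2v) *m lin1_mx (v2r \o h' \o r2v).
  by apply/row_matrixP=> i; rewrite !rowE mulmxA !mul_rV_lin1 /= v2rK.
by rewrite /tmap !e trmx_mul !mulmxA.
Qed.

Lemma tmap_linl (U U' V V' : vectType K) (a : K) (f f' h : U -> U')
    (g : V -> V') t :
  (forall u, h u = a *: f u + f' u) ->
  tmap h g t = a *: tmap f g t + tmap f' g t.
Proof.
move=> hE; rewrite /tmap; have -> : lin1_mx (v2r \o h \o r2v) =
    a *: lin1_mx (v2r \o f \o r2v) + lin1_mx (v2r \o f' \o r2v).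
  by apply/matrixP=> i j; rewrite !mxE /= hE linearP !mxE.
by rewrite linearP /= !mulmxDl -!scalemxAl.
Qed.

Lemma tmap_linr (U U' V V' : vectType K) (a : K) (f : U -> U')
    (g g' h : V -> V') t :
  (forall v, h v = a *: g v + g' v) ->
  tmap f h t = a *: tmap f g t + tmap f g' t.
Proof.
move=> hE; rewrite /tmap; have -> : lin1_mx (v2r \o h \o r2v) =
    a *: lin1_mx (v2r \o g \o r2v) + lin1_mx (v2r \o g' \o r2v).
  by apply/matrixP=> i j; rewrite !mxE /= hE linearP !mxE.
by rewrite mulmxDr -scalemxAr.
Qed.

End TensorK.

(* Finite dimensional left modules and bimodules over a finite dimensional
   algebra [A]. *)

Section Modules.
Variables (K : fieldType) (A : falgType K).

Record lmodule := LModule {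
  lm_car :> vectType K;
  lm_act : A -> lm_car -> lm_car;
  lm_act_linl : forall v, linear (lm_act^~ v);
  lm_act_linr : forall a, linear (lm_act a);
  lm_act1 : forall v, lm_act 1 v = v;
  lm_actM : forall a b v, lm_act (a * b) v = lm_act a (lm_act b v)
}.

HB.instance Definition _ (V : lmodule) (a : A) :=
  GRing.isLinear.Build K V V _ (lm_act a) (lm_act_linr a).

Record lmod_hom (V W : lmodule) := LmodHom {
  lmod_fun :> 'Hom(V, W);
  lmod_funP : forall a v, lmod_fun (lm_act a v) = lm_act a (lmod_fun v)
}.

Lemma lmod_hom_ext (V W : lmodule) (f g : lmod_hom V W) : f =1 g -> f = g.
Proof.
case: f g => [f fP] [g gP] /= fg; have e : f = g by apply/lfunP.
by case: _ / e gP {fg} => gP; congr LmodHom; apply: Prop_irrelevance.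
Qed.

Lemma lmod_id_subproof (V : lmodule) (a : A) (v : V) :
  \1%VF (lm_act a v) = lm_act a (\1%VF v).
Proof. by rewrite !id_lfunE. Qed.
Definition lmod_id (V : lmodule) : lmod_hom V V :=
  LmodHom (@lmod_id_subproof V).

Lemma lmod_comp_subproof (V W Z : lmodule) (g : lmod_hom W Z)
    (f : lmod_hom V W) (a : A) (v : V) :
  (g \o f)%VF (lm_act a v) = lm_act a ((g \o f)%VF v).
Proof. by rewrite !comp_lfunE !lmod_funP. Qed.
Definition lmod_comp (V W Z : lmodule) (g : lmod_hom W Z) (f : lmod_hom V W) :
  lmod_hom V Z := LmodHom (@lmod_comp_subproof _ _ _ g f).

Lemma lmod_comp1m V W (f : lmod_hom V W) : lmod_comp (lmod_id W) f = f.
Proof. by apply: lmod_hom_ext => v; rewrite /= comp_lfunE id_lfunE. Qed.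
Lemma lmod_compm1 V W (f : lmod_hom V W) : lmod_comp f (lmod_id V) = f.
Proof. by apply: lmod_hom_ext => v; rewrite /= comp_lfunE id_lfunE. Qed.
Lemma lmod_compA V W Z T (h : lmod_hom Z T) (g : lmod_hom W Z)
    (f : lmod_hom V W) :
  lmod_comp h (lmod_comp g f) = lmod_comp (lmod_comp h g) f.
Proof. by apply: lmod_hom_ext => v; rewrite /= !comp_lfunE. Qed.

Definition lmod_cat : category := Category lmod_comp1m lmod_compm1 lmod_compA.

Record bimodule := Bimodule {
  bm_car :> vectType K;
  lact : A -> bm_car -> bm_car;
  ract : bm_car -> A -> bm_car;
  lact_linl : forall u, linear (lact^~ u);
  lact_linr : forall a, linear (lact a);
  lact1 : forall u, lact 1 u = u;
  lactM : forall a b u, lact (a * b) u = lact a (lact b u);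
  ract_linr : forall u, linear (ract u);
  ract_linl : forall a, linear (ract^~ a);
  ract1 : forall u, ract u 1 = u;
  ractM : forall a b u, ract u (a * b) = ract (ract u a) b;
  lractA : forall a b u, ract (lact a u) b = lact a (ract u b)
}.

HB.instance Definition _ (U : bimodule) (a : A) :=
  GRing.isLinear.Build K U U _ (lact a) (lact_linr a).
HB.instance Definition _ (U : bimodule) (u : U) :=
  GRing.isLinear.Build K A U _ (ract u) (ract_linr u).

Definition bimod_mor (U V : bimodule) (f : 'Hom(U, V)) : Prop :=
  (forall a u, f (lact a u) = lact a (f u)) /\
  (forall a u, f (ract u a) = ract (f u) a).

Definition bimod_iso (U V : bimodule) : Prop :=
  exists2 f : 'Hom(U, V), bimod_mor f & bijective f.

Definition bimod_summand (U V : bimodule) : Prop :=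
  exists (i : 'Hom(U, V)) (p : 'Hom(V, U)),
    [/\ bimod_mor i, bimod_mor p & cancel i p].

Section TensorFunctor.
Variable U : bimodule.

(* [U (x)_A V] is the quotient of [U (x)_K V] by the span of all elements
   [u a (x) v - u (x) a v], for which it is enough to let [u], [a] and [v] run
   over bases; see [tens_relP]. *)
Definition tens_rel (V : lmodule) : {vspace tensK U V} :=
  (\sum_(i < \dim {:U}) \sum_(j < \dim {:A}) \sum_(l < \dim {:V})
     let u := (vbasis {:U})`_i in
     let a := (vbasis {:A})`_j in
     let v := (vbasis {:V})`_l in
     <[tens (ract u a) v - tens u (lm_act a v)]>)%VS.

Lemma tens_relP (V : lmodule) u a (v : V) :
  tens (ract u a) v - tens u (lm_act a v) \in tens_rel V.
Proof.
pose r u a v : tensK U V := tens (ract u a) v - tens u (lm_act a v).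
have l1 a' v' : linear (fun u => r u a' v').
  move=> c u1 u2; rewrite /r ract_linl !tens_linl scalerBr opprD addrACA.
  by [].
have l2 u' v' : linear (fun a => r u' a v').
  move=> c a1 a2; rewrite /r ract_linr tens_linl lm_act_linl tens_linr.
  by rewrite scalerBr opprD addrACA.
have l3 u' a' : linear (fun v => r u' a' v).
  move=> c v1 v2; rewrite /r lm_act_linr !tens_linr.
  by rewrite scalerBr opprD addrACA.
have span (X : vectType K) (S : {vspace tensK U V}) (h : X -> tensK U V) x :
    linear h -> (forall i : 'I_(\dim {:X}), h (vbasis {:X})`_i \in S) ->
    h x \in S.
  move=> hl hS; pose h' := GRing.isLinear.Build K _ _ _ h hl.
  pose H : {linear X -> tensK U V} := HB.pack h h'.
  rewrite (coord_vbasis (memvf x)) -[h]/(H : _ -> _) linear_sum.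
  by apply: memv_suml => i _; rewrite linearZ memvZ //; apply: hS.
rewrite -[_ - _]/(r u a v); apply: (span _ _ (fun u => r u a v)) => // i.
apply: (span _ _ (fun a => r _ a v)) => // j.
apply: (span _ _ (fun v => r _ _ v)) => // l.
by rewrite memvE /tens_rel (sumv_sup i) // (sumv_sup j) // (sumv_sup l).
Qed.

Lemma tens_rel_ind (V : lmodule) (X : vectType K) (S : {vspace X})
    (g : {linear tensK U V -> X}) :
  (forall u a v, g (tens (ract u a) v - tens u (lm_act a v)) \in S) ->
  forall w, w \in tens_rel V -> g w \in S.
Proof.
move=> gS w; suff: (tens_rel V <= linfun g @^-1: S)%VS.
  by move=> /subvP sub /sub; rewrite -memv_preim lfunE.
do 3!apply/subv_sumP=> ? _.
by rewrite -memvE -memv_preim lfunE /=.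
Qed.

Lemma tmapl_rel (V : lmodule) a w :
  w \in tens_rel V -> tmap (lact a) idfun w \in tens_rel V.
Proof.
apply: tens_rel_ind => u b v.
by rewrite linearB /= !tmapE /= -lractA tens_relP.
Qed.

Lemma tmapr_rel (V W : lmodule) (f : lmod_hom V W) w :
  w \in tens_rel V -> tmap idfun f w \in tens_rel W.
Proof.
apply: tens_rel_ind => u b v.
by rewrite linearB /= !tmapE /= lmod_funP tens_relP.
Qed.

Section Object.
Variable V : lmodule.

Definition tensA_act (a : A) : quotv (tens_rel V) -> quotv (tens_rel V) :=
  qmap (tmap (lact a) idfun).

Lemma tensA_act_linl t : linear (tensA_act^~ t).
Proof.
move=> c a b; rewrite /tensA_act /qmap -linearP; congr qproj.
by apply: tmap_linl => u; rewrite lact_linl.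
Qed.
Lemma tensA_act_linr a : linear (tensA_act a).
Proof. by apply: qmap_linear; apply: linearP. Qed.
Lemma tensA_act1 t : tensA_act 1 t = t.
Proof.
rewrite /tensA_act /qmap (eq_tmap _ (f' := idfun) (g' := idfun)) //.
  by rewrite tmap_id qliftK.
by move=> u; rewrite lact1.
Qed.
Lemma tensA_actM a b t : tensA_act (a * b) t = tensA_act a (tensA_act b t).
Proof.
rewrite /tensA_act qmap_comp; last exact: tmapl_rel.
apply: eq_qmap => w; rewrite /= tmap_comp.
by apply: eq_tmap => // u; rewrite /= lactM.
Qed.

Definition tensA : lmodule :=
  LModule tensA_act_linl tensA_act_linr tensA_act1 tensA_actM.

End Object.

Section Morphism.
Variables (V W : lmodule) (f : lmod_hom V W).

Let fmapt : quotv (tens_rel V) -> quotv (tens_rel W) := qmap (tmap idfun f).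

Lemma tensA_map_linear : linear fmapt.
Proof. by apply: qmap_linear; apply: linearP. Qed.
HB.instance Definition _ :=
  GRing.isLinear.Build K (quotv (tens_rel V)) (quotv (tens_rel W)) _ fmapt
    tensA_map_linear.

Definition tensA_lfun : 'Hom(tensA V, tensA W) := linfun fmapt.

Lemma tensA_lfunE t : tensA_lfun t = qmap (tmap idfun f) t.
Proof. by rewrite lfunE. Qed.

Lemma tensA_lfunP a t : tensA_lfun (lm_act a t) = lm_act a (tensA_lfun t).
Proof.
rewrite !tensA_lfunE /= /tensA_act.
rewrite [LHS]qmap_comp; last exact: tmapr_rel.
rewrite [RHS]qmap_comp; last exact: tmapl_rel.
by apply: eq_qmap => w; rewrite /= !tmap_comp.
Qed.

Definition tensA_hom : lmod_hom (tensA V) (tensA W) := LmodHom tensA_lfunP.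

End Morphism.

Lemma tensA_hom1 V : tensA_hom (lmod_id V) = lmod_id (tensA V).
Proof.
apply: lmod_hom_ext => t; rewrite /= tensA_lfunE id_lfunE /qmap.
rewrite (eq_tmap _ (f' := idfun) (g' := idfun)) ?tmap_id ?qliftK //.
by move=> v; rewrite /= id_lfunE.
Qed.

Lemma tensA_homM V W Z (g : lmod_hom W Z) (f : lmod_hom V W) :
  tensA_hom (lmod_comp g f) = lmod_comp (tensA_hom g) (tensA_hom f).
Proof.
apply: lmod_hom_ext => t; rewrite /= comp_lfunE !tensA_lfunE.
rewrite [RHS]qmap_comp; last exact: tmapr_rel.
apply: eq_qmap => w; rewrite /= tmap_comp.
by apply: eq_tmap => // v; rewrite /= comp_lfunE.
Qed.

(* The functor [U (x)_A -]. *)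
Definition tensF : functor lmod_cat lmod_cat :=
  @Functor lmod_cat lmod_cat tensA tensA_hom tensA_hom1 tensA_homM.

End TensorFunctor.

Lemma bimod0_linear (T : lmodType K) : linear (fun _ : T => 0 : 'rV[K]_0).
Proof. by move=> c u v; rewrite scaler0 addr0. Qed.
Lemma bimod0_eq (u v : 'rV[K]_0) : u = v.
Proof. by apply/rowP=> -[]. Qed.

Definition bimod0 : bimodule :=
  @Bimodule 'rV[K]_0 (fun _ _ => 0) (fun _ _ => 0)
    (fun _ => @bimod0_linear _) (fun _ => @bimod0_linear _)
    (fun _ => bimod0_eq _ _) (fun _ _ _ => bimod0_eq _ _)
    (fun _ => @bimod0_linear _) (fun _ => @bimod0_linear _)
    (fun _ => bimod0_eq _ _) (fun _ _ _ => bimod0_eq _ _)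
    (fun _ _ _ => bimod0_eq _ _).

Section DirectSum.
Variables U V : bimodule.

Definition sum_lact (a : A) (w : U * V) : U * V := (lact a w.1, lact a w.2).
Definition sum_ract (w : U * V) (a : A) : U * V := (ract w.1 a, ract w.2 a).

Lemma sum_lact_linl w : linear (sum_lact^~ w).
Proof. by move=> c a b; rewrite /sum_lact !lact_linl. Qed.
Lemma sum_lact_linr a : linear (sum_lact a).
Proof. by move=> c w z; rewrite /sum_lact !lact_linr. Qed.
Lemma sum_lact1 w : sum_lact 1 w = w.
Proof. by case: w => u v; rewrite /sum_lact !lact1. Qed.
Lemma sum_lactM a b w : sum_lact (a * b) w = sum_lact a (sum_lact b w).
Proof. by rewrite /sum_lact !lactM. Qed.
Lemma sum_ract_linr w : linear (sum_ract w).
Proof. by move=> c a b; rewrite /sum_ract !ract_linr. Qed.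
Lemma sum_ract_linl a : linear (sum_ract^~ a).
Proof. by move=> c w z; rewrite /sum_ract !ract_linl. Qed.
Lemma sum_ract1 w : sum_ract w 1 = w.
Proof. by case: w => u v; rewrite /sum_ract !ract1. Qed.
Lemma sum_ractM a b w : sum_ract w (a * b) = sum_ract (sum_ract w a) b.
Proof. by rewrite /sum_ract !ractM. Qed.
Lemma sum_lractA a b w : sum_ract (sum_lact a w) b = sum_lact a (sum_ract w b).
Proof. by rewrite /sum_ract /sum_lact !lractA. Qed.

Definition bimod_sum : bimodule :=
  Bimodule sum_lact_linl sum_lact_linr sum_lact1 sum_lactM sum_ract_linr
    sum_ract_linl sum_ract1 sum_ractM sum_lractA.

End DirectSum.

(* The additive closure: closure under finite direct sums, direct summands and
   isomorphism (an isomorphic bimodule being a direct summand). *)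
Inductive add_closure (P : bimodule -> Prop) : bimodule -> Prop :=
| add_gen U : P U -> add_closure P U
| add_zero : add_closure P bimod0
| add_sum U V :
    add_closure P U -> add_closure P V -> add_closure P (bimod_sum U V)
| add_summand U V :
    bimod_summand U V -> add_closure P V -> add_closure P U.

Definition is_subbimod (U : bimodule) (W : {vspace U}) : Prop :=
  (forall a w, w \in W -> lact a w \in W) /\
  (forall a w, w \in W -> ract w a \in W).

Lemma subbimodD (U : bimodule) (W W' : {vspace U}) :
  is_subbimod W -> is_subbimod W' -> is_subbimod (W + W')%VS.
Proof.
move=> [Wl Wr] [Wl' Wr'].
split=> a _ /memv_addP [w wW [w' wW' ->]].
  by rewrite linearD memv_add ?Wl ?Wl'.
have -> : ract (w + w') a = ract w a + ract w' a.
  by have := ract_linl a 1 w w'; rewrite !scale1r.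
by rewrite memv_add ?Wr ?Wr'.
Qed.

Section QuotientBimodule.
Variables (U : bimodule) (W : {vspace U}).
Hypothesis subW : is_subbimod W.

Definition quot_lact (a : A) : quotv W -> quotv W := qmap (lact a).
Definition quot_ract (t : quotv W) (a : A) : quotv W :=
  qmap (fun u : U => ract u a) t.

Let raL a : {linear U -> U} :=
  HB.pack (fun u : U => ract u a)
    (GRing.isLinear.Build K U U _ _ (@ract_linl U a)).

Lemma quot_lact_linl t : linear (quot_lact^~ t).
Proof. by move=> c a b; rewrite /quot_lact /qmap lact_linl linearP. Qed.
Lemma quot_lact_linr a : linear (quot_lact a).
Proof. by apply: qmap_linear; apply: linearP. Qed.
Lemma quot_lact1 t : quot_lact 1 t = t.
Proof. by rewrite /quot_lact /qmap lact1 qliftK. Qed.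
Lemma quot_lactM a b t : quot_lact (a * b) t = quot_lact a (quot_lact b t).
Proof.
rewrite /quot_lact qmap_comp; last exact: subW.1.
by apply: eq_qmap => u; rewrite /= lactM.
Qed.
Lemma quot_ract_linr t : linear (quot_ract t).
Proof. by move=> c a b; rewrite /quot_ract /qmap ract_linr linearP. Qed.
Lemma quot_ract_linl a : linear (quot_ract^~ a).
Proof. by apply: (@qmap_linear _ _ _ _ _ (raL a)); apply: linearP. Qed.
Lemma quot_ract1 t : quot_ract t 1 = t.
Proof. by rewrite /quot_ract /qmap ract1 qliftK. Qed.
Lemma quot_ractM a b t : quot_ract t (a * b) = quot_ract (quot_ract t a) b.
Proof.
rewrite /quot_ract (@qmap_comp _ _ _ _ _ _ _ (raL b)); last exact: subW.2.
by apply: eq_qmap => u; rewrite /= ractM.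
Qed.
Lemma quot_lractA a b t :
  quot_ract (quot_lact a t) b = quot_lact a (quot_ract t b).
Proof.
rewrite /quot_ract /quot_lact.
rewrite (@qmap_comp _ _ _ _ _ _ _ (raL b)); last exact: subW.2.
rewrite qmap_comp; last exact: subW.1.
by apply: eq_qmap => u; rewrite /= lractA.
Qed.

Definition quot_bimod : bimodule :=
  Bimodule quot_lact_linl quot_lact_linr quot_lact1 quot_lactM quot_ract_linr
    quot_ract_linl quot_ract1 quot_ractM quot_lractA.

End QuotientBimodule.

(* The regular bimodule [A] and the bimodule [A (x)_K A]. *)

Lemma reg_linl (a : A) : linear (fun b => b * a).
Proof. by move=> c b b'; rewrite mulrDl scalerAl. Qed.
Lemma reg_linr (a : A) : linear (fun b => a * b).
Proof. by move=> c b b'; rewrite mulrDr scalerAr. Qed.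

Definition reg_bimod : bimodule :=
  @Bimodule A (fun a b => a * b) (fun b a => b * a)
    reg_linl reg_linr (@mul1r A) (fun a b c => esym (mulrA a b c))
    reg_linr reg_linl (@mulr1 A) (fun a b c => mulrA c a b)
    (fun a b c => esym (mulrA a c b)).

Definition split_lact (a : A) : tensK A A -> tensK A A :=
  tmap (fun b => a * b) idfun.
Definition split_ract (t : tensK A A) (a : A) : tensK A A :=
  tmap idfun (fun b => b * a) t.

Let mL a : {linear A -> A} :=
  HB.pack (fun b : A => a * b) (GRing.isLinear.Build K A A _ _ (reg_linr a)).
Let mR a : {linear A -> A} :=
  HB.pack (fun b : A => b * a) (GRing.isLinear.Build K A A _ _ (reg_linl a)).

Lemma split_lact_linl t : linear (split_lact^~ t).
Proof. by move=> c a b; apply: tmap_linl => u; rewrite reg_linl. Qed.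
Lemma split_lact_linr a : linear (split_lact a).
Proof. exact: linearP. Qed.
Lemma split_lact1 t : split_lact 1 t = t.
Proof.
rewrite -[RHS]tmap_id; apply: eq_tmap => // b; exact: mul1r.
Qed.
Lemma split_lactM a b t : split_lact (a * b) t = split_lact a (split_lact b t).
Proof.
rewrite /split_lact (tmap_comp (mL a) (mL b)).
by apply: eq_tmap => // c; rewrite /= mulrA.
Qed.
Lemma split_ract_linr t : linear (split_ract t).
Proof. by move=> c a b; apply: tmap_linr => u; rewrite reg_linr. Qed.
Lemma split_ract_linl a : linear (split_ract^~ a).
Proof. by move=> c s t; rewrite /split_ract linearP. Qed.
Lemma split_ract1 t : split_ract t 1 = t.
Proof.
rewrite -[RHS]tmap_id; apply: eq_tmap => // b; exact: mulr1.
Qed.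
Lemma split_ractM a b t : split_ract t (a * b) = split_ract (split_ract t a) b.
Proof.
rewrite /split_ract (tmap_comp idfun idfun (mR b) (mR a)).
by apply: eq_tmap => // c; rewrite /= mulrA.
Qed.
Lemma split_lractA a b t :
  split_ract (split_lact a t) b = split_lact a (split_ract t b).
Proof.
rewrite /split_ract /split_lact (tmap_comp idfun (mL a) (mR b) idfun).
by rewrite (tmap_comp (mL a) idfun idfun (mR b)).
Qed.

Definition split_bimod : bimodule :=
  Bimodule split_lact_linl split_lact_linr split_lact1 split_lactM
    split_ract_linr split_ract_linl split_ract1 split_ractM split_lractA.

End Modules.

(* The algebra [D = K[x]/(x^2)]; [dn_re d] and [dn_eps d] are the coordinates of
   [d] in the basis [1, x]. *)

Definition dual_num (K : fieldType) : Type := {poly %/ ('X^2 : {poly K})}.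
HB.instance Definition _ (K : fieldType) := GRing.UnitAlgebra.on (dual_num K).
HB.instance Definition _ (K : fieldType) := Vector.on (dual_num K).

Section StringBimodules.
Variable K : fieldType.
Local Notation D := (dual_num K).

Definition dn_x : D := in_qpoly 'X^2 'X.
Definition dn_re (d : D) : K := (polyn d)`_0.
Definition dn_eps (d : D) : K := (polyn d)`_1.

Lemma dn_reP c (a b : D) : dn_re (c *: a + b) = c * dn_re a + dn_re b.
Proof. by rewrite /dn_re /= coefD coefZ. Qed.
Lemma dn_epsP c (a b : D) : dn_eps (c *: a + b) = c * dn_eps a + dn_eps b.
Proof. by rewrite /dn_eps /= coefD coefZ. Qed.
Lemma dn_re1 : dn_re 1 = 1.
Proof. by rewrite /dn_re /= coefC. Qed.
Lemma dn_eps1 : dn_eps 1 = 0.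
Proof. by rewrite /dn_eps /= coefC. Qed.
Lemma dn_coefM (a b : D) i : (i < 2)%N ->
  (polyn (a * b))`_i = (polyn a * polyn b)`_i.
Proof.
move=> i2; rewrite poly_of_qpolyM; move: (polyn a * polyn b) => q.
by rewrite mk_monic_Xn -Pdiv.RingMonic.take_poly_rmodp coef_take_poly i2.
Qed.
Lemma dn_reM (a b : D) : dn_re (a * b) = dn_re a * dn_re b.
Proof. by rewrite /dn_re dn_coefM // coefM big_ord1. Qed.
Lemma dn_epsM (a b : D) :
  dn_eps (a * b) = dn_re a * dn_eps b + dn_eps a * dn_re b.
Proof. by rewrite /dn_eps dn_coefM // coefM big_ord_recr big_ord1. Qed.
Lemma dn_x_coef i : (polyn dn_x)`_i = (i == 1)%:R.
Proof. by rewrite /dn_x qpolyXE ?size_polyXn ?monicXn // coefX. Qed.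

Section Construction.
Variables (n : nat) (X Y : 'M[K]_n).
Hypotheses (X2 : X *m X = 0) (Y2 : Y *m Y = 0) (XY : X *m Y = Y *m X).

Definition dn_act (Z : 'M[K]_n) (d : D) (v : 'rV[K]_n) : 'rV[K]_n :=
  dn_re d *: v + dn_eps d *: (v *m Z).

Lemma dn_act_linl Z v : linear (dn_act Z ^~ v).
Proof.
move=> c a b; rewrite /dn_act dn_reP dn_epsP !scalerDl -!scalerA.
by rewrite scalerDr addrACA.
Qed.
Lemma dn_act_linr Z a : linear (dn_act Z a).
Proof.
move=> c u v; rewrite /dn_act mulmxDl -scalemxAl !scalerDr.
by rewrite !(scalerA c) !(mulrC c) -!scalerA addrACA.
Qed.
Lemma dn_act1 Z v : dn_act Z 1 v = v.
Proof. by rewrite /dn_act dn_re1 dn_eps1 scale1r scale0r addr0. Qed.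
Lemma dn_actM Z a b v : Z *m Z = 0 ->
  dn_act Z (a * b) v = dn_act Z a (dn_act Z b v).
Proof.
move=> Z2; rewrite /dn_act dn_reM dn_epsM mulmxDl -!scalemxAl -mulmxA Z2.
by rewrite mulmx0 scaler0 addr0 scalerDr !scalerA -addrA -scalerDl.
Qed.
Lemma dn_actC a b v :
  dn_act Y b (dn_act X a v) = dn_act X a (dn_act Y b v).
Proof.
rewrite /dn_act !mulmxDl -!scalemxAl -!mulmxA XY !scalerDr !scalerA.
by rewrite addrACA ![dn_re b * _]mulrC ![dn_eps b * _]mulrC.
Qed.

(* The D-D-bimodule of row vectors on which [x] acts from the left by
   [v |-> v *m X] and from the right by [v |-> v *m Y]. *)
Definition dn_bimod : bimodule D :=
  @Bimodule K D 'rV[K]_n (dn_act X) (fun v a => dn_act Y a v)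
    (dn_act_linl X) (dn_act_linr X) (dn_act1 X)
    (fun a b v => dn_actM a b v X2)
    (dn_act_linl Y) (dn_act_linr Y) (dn_act1 Y)
    (fun a b v => etrans (congr1 (fun c => dn_act Y c v) (mulrC a b))
                         (dn_actM b a v Y2))
    dn_actC.

End Construction.

Section String.
Variable k : nat.

(* [m_ i] is the basis vector with 1-based index [i], [1 <= i <= 2k+3]. *)
Definition m_ (i : nat) : 'rV[K]_(2 * k + 3) :=
  \row_j ((j : nat).+1 == i)%:R.

(* [x m_i = m_(i+1)] and [m_i x = m_(i-1)] for [i] even, and [x] kills [m_i] on
   both sides for [i] odd; see [m_xl] and [m_xr].  Row and column [r] of these
   matrices correspond to [m_(r+1)]. *)
Definition string_xl : 'M[K]_(2 * k + 3) :=
  \matrix_(i, j) (odd i && ((j : nat) == i.+1))%:R.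
Definition string_xr : 'M[K]_(2 * k + 3) :=
  \matrix_(i, j) (odd i && ((i : nat) == j.+1))%:R.

Lemma string_mulE (Z1 Z2 : 'M[K]_(2 * k + 3)) :
  (forall i j : 'I_(2 * k + 3), odd i = odd j -> Z1 i j = 0) ->
  (forall i j : 'I_(2 * k + 3), ~~ odd i -> Z2 i j = 0) ->
  (forall i j : 'I_(2 * k + 3), ~~ odd i -> Z1 i j = 0) ->
  Z1 *m Z2 = 0.
Proof.
move=> Z1p Z2e Z1e; apply/matrixP=> i j; rewrite !mxE big1 // => l _.
have [ol|el] := boolP (odd l); last by rewrite Z2e ?mulr0.
have [oi|ei] := boolP (odd i); last by rewrite Z1e ?mul0r.
by rewrite Z1p ?mul0r // oi ol.
Qed.

Lemma string_xl_par (i j : 'I_(2 * k + 3)) : odd i = odd j -> string_xl i j = 0.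
Proof.
rewrite mxE; case: eqP => [->|_]; last by rewrite andbF.
by rewrite /=; case: (odd i).
Qed.
Lemma string_xr_par (i j : 'I_(2 * k + 3)) : odd i = odd j -> string_xr i j = 0.
Proof.
rewrite mxE; case: eqP => [->|_]; last by rewrite andbF.
by rewrite /=; case: (odd j).
Qed.
Lemma string_xl_even (i j : 'I_(2 * k + 3)) : ~~ odd i -> string_xl i j = 0.
Proof. by rewrite mxE => /negPf ->. Qed.
Lemma string_xr_even (i j : 'I_(2 * k + 3)) : ~~ odd i -> string_xr i j = 0.
Proof. by rewrite mxE => /negPf ->. Qed.

Lemma string_xl2 : string_xl *m string_xl = 0.
Proof.
apply: string_mulE; [exact: string_xl_par | exact: string_xl_even |].
exact: string_xl_even.
Qed.
Lemma string_xr2 : string_xr *m string_xr = 0.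
Proof.
apply: string_mulE; [exact: string_xr_par | exact: string_xr_even |].
exact: string_xr_even.
Qed.
Lemma string_xlr : string_xl *m string_xr = string_xr *m string_xl.
Proof.
rewrite !string_mulE //; first [exact: string_xl_par | exact: string_xl_even
  | exact: string_xr_par | exact: string_xr_even].
Qed.

Definition M_ : bimodule D := dn_bimod string_xl2 string_xr2 string_xlr.

Lemma m_mul (Z : 'M[K]_(2 * k + 3)) (i : 'I_(2 * k + 3)) :
  m_ i.+1 *m Z = row i Z.
Proof.
apply/rowP=> j; rewrite !mxE (bigD1 i) //= !mxE eqxx mul1r big1 ?addr0 // => l.
by rewrite mxE eqSS (inj_eq val_inj) => /negPf ->; rewrite mul0r.
Qed.

Lemma m_xl (i : nat) : (0 < i <= 2 * k + 3)%N ->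
  lact (dn_x : D) (m_ i : M_) = if odd i then 0 else m_ i.+1.
Proof.
case: i => // i ilt; rewrite /= /dn_act /dn_re /dn_eps !dn_x_coef.
rewrite scale0r add0r scale1r (m_mul _ (Ordinal ilt)); apply/rowP=> j.
by rewrite !mxE /=; case: (odd i); rewrite /= mxE ?eqSS.
Qed.

Lemma m_xr (i : nat) : (0 < i <= 2 * k + 3)%N ->
  ract (m_ i : M_) (dn_x : D) = if odd i then 0 else m_ i.-1.
Proof.
case: i => // i ilt; rewrite /= /dn_act /dn_re /dn_eps !dn_x_coef.
rewrite scale0r add0r scale1r (m_mul _ (Ordinal ilt)); apply/rowP=> j.
by rewrite !mxE /=; case: (odd i); rewrite /= mxE // eq_sym.
Qed.

Lemma dn_act_odd (Z : 'M[K]_(2 * k + 3)) (i : nat) (d : D) (c : K) :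
  (forall i j : 'I_(2 * k + 3), ~~ odd i -> Z i j = 0) ->
  odd i -> (i <= 2 * k + 3)%N ->
  dn_act Z d (c *: m_ i) = (dn_re d * c) *: m_ i.
Proof.
case: i => // i Z0 oi ilt; rewrite /dn_act scalerA -scalemxAl.
rewrite (m_mul _ (Ordinal ilt)).
have -> : row (Ordinal ilt) Z = 0 by apply/rowP=> j; rewrite !mxE Z0.
by rewrite !scaler0 addr0.
Qed.

Lemma m_odd_subbimod (i : nat) : odd i -> (i <= 2 * k + 3)%N ->
  is_subbimod (U := M_) <[m_ i : M_]>%VS.
Proof.
move=> oi ilt; split=> d _ /vlineP [c ->].
  by rewrite [lact _ _](dn_act_odd _ _ string_xl_even) // memvZ ?memv_line.
by rewrite [ract _ _](dn_act_odd _ _ string_xr_even) // memvZ ?memv_line.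
Qed.

Lemma m_first_subbimod : is_subbimod (U := M_) <[m_ 1 : M_]>%VS.
Proof. by apply: m_odd_subbimod; rewrite // addnC. Qed.
Lemma m_last_subbimod : is_subbimod (U := M_) <[m_ (2 * k + 3) : M_]>%VS.
Proof. by apply: m_odd_subbimod; rewrite // oddD mul2n odd_double. Qed.
Lemma m_both_subbimod :
  is_subbimod (U := M_) (<[m_ 1 : M_]> + <[m_ (2 * k + 3) : M_]>)%VS.
Proof. exact: subbimodD m_first_subbimod m_last_subbimod. Qed.

Definition N_ : bimodule D := quot_bimod m_last_subbimod.
Definition S_ : bimodule D := quot_bimod m_first_subbimod.
Definition W_ : bimodule D := quot_bimod m_both_subbimod.

End String.

(* The two-sided cells, up to isomorphism of bimodules. *)
Definition J_split (U : bimodule D) : Prop :=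
  [\/ bimod_iso U (split_bimod D), bimod_iso U (W_ 0), bimod_iso U (S_ 0) |
      bimod_iso U (N_ 0)].

Definition J_ (k : nat) (U : bimodule D) : Prop :=
  if k is 0 then bimod_iso U (M_ 0)
  else [\/ bimod_iso U (W_ k), bimod_iso U (S_ k), bimod_iso U (N_ k) |
           bimod_iso U (M_ k)].

(* The cells [>=_J J_ m] are [J_split] and [J_ j] with [j <= m]; the identity
   1-morphism is the regular bimodule. *)
Definition trunc_gen (m : nat) (U : bimodule D) : Prop :=
  [\/ J_split U, exists2 j, (j <= m)%N & J_ j U | bimod_iso U (reg_bimod D)].

(* [C] is a category with an equivalence [E] to D-mod. *)
Section TwoCategory.
Variables (C : category) (E : functor C (lmod_cat D)).

(* [F] is isomorphic to the endofunctor of [C] given by [U (x)_D -]. *)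
Definition is_tensor (U : bimodule D) (F : functor C C) : Prop :=
  nat_iso (compF E F) (compF (tensF U) E).

Lemma is_tensor_exists (U : bimodule D) :
  is_equivalence E -> exists F : functor C C, is_tensor U F.
Proof.
case=> E' [_ [a [b [ba ab]]]]; pose T := compF (tensF U) E.
have aN X Y (f : hom X Y) : comp (a (T Y)) (fmap (compF E (compF E' T)) f) =
    comp (fmap T f) (a (T X)) by exact: (ntP a (fmap T f)).
have bN X Y (f : hom X Y) : comp (b (T Y)) (fmap T f) =
    comp (fmap (compF E (compF E' T)) f) (b (T X)) by exact: (ntP b (fmap T f)).
exists (compF E' T), (@NatTrans _ _ (compF E (compF E' T)) T _ aN).
exists (@NatTrans _ _ T (compF E (compF E' T)) _ bN).
by split=> X; [exact: (ba (T X)) | exact: (ab (T X))].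
Qed.

(* The 1-morphisms of the 2-full 2-subcategory D^(m). *)
Definition trunc_mor (m : nat) (F : functor C C) : Prop :=
  exists2 U, add_closure (trunc_gen m) U & is_tensor U F.

Definition cell_NM (k : nat) (F : functor C C) : Prop :=
  is_tensor (N_ k) F \/ is_tensor (M_ k) F.

End TwoCategory.

End StringBimodules.

(* Main.v *)
From HB Require Import structures.
From mathcomp Require Import all_boot all_algebra all_field zify.
From mathcomp Require Import boolp.
Require Import Defs.

Set Implicit Arguments.
Unset Strict Implicit.
Unset Printing Implicit Defensive.
Import GRing.Theory VectorInternalTheory.

(** Write [t_i] ([0 <= i <= k]) for the basis vector [m_(2i+2)] of [M_k].  These
    vectors generate the bimodule [M_k], and for [k >= 1] the links
    [x t_i = t_(i+1) x], [i < k], are defining relations; the odd basis vectors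
    are [t_0 x], the common values of both sides of the links, and [x t_k].

    The idea is that [M_k] behaves like a coalgebra.  The links make
    [t_i |-> 1] a bimodule map [phi : M_k -> D] (a counit), and they are
    respected by the diagonal [t_i |-> t_i (x) t_i], because
    [x t_i (x) t_i = t_(i+1) x (x) t_i = t_(i+1) (x) t_(i+1) x].  The diagonal
    splits [M_k phi : M_k (x) M_k -> M_k].  As it sends the last basis vector
    [x t_k] to [x t_k (x) t_k], it induces a splitting of [N_k phi] on the
    quotient [N_k] of [M_k] by that vector.  So [M_k] is good via [phi].

    Conversely let [phi' : U -> D] be such that [M_k phi'] is split by some
    [xi : M_k -> M_k (x) U].  Let [u_i] in [U] be the diagonal coefficient of
    [xi], that is the coefficient of [t_i] in [xi (t_i)].  Comparing the
    coefficients of [t_(i+1)] in [x xi(t_i) = xi(t_(i+1)) x] gives the links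
    [x u_i = u_(i+1) x], and the splitting gives [phi' (u_i) = 1].  Hence
    [t_i |-> u_i] is a bimodule map [beta : M_k -> U] with [phi' beta = phi].

    Everything is carried out for the functors [U (x)_D -] on D-mod, composed
    with the equivalence [E].  A natural transformation from [M_k (x) E] is a
    natural family of sequences of linear maps, the images of the [t_i (x) v],
    that satisfies the links ([string_quot_nat]); this is used to build the
    counit ([counit_exists]), the diagonal ([diagonal_exists]) and [beta]
    ([counit_represents]).  Bimodule elements such as [u_i] are obtained by
    evaluating natural transformations at an object [X0] of [C] such that
    [E X0] is free of rank one ([equiv_free]).  The last part moves splittings
    and factorizations along the equivalence ([splitting_lift],
    [splitting_push]). *)

Local Open Scope ring_scope.

(** * Tensor products over an algebra *)

Lemma linear_fun0 (K : fieldType) (V W : lmodType K) (f : V -> W) :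
  linear f -> f 0 = 0.
Proof.
by move=> fl; have := fl (-1) 0 0; rewrite scaler0 addr0 scaleN1r addNr.
Qed.

Lemma lmod_compE (K : fieldType) (A : falgType K) (V W Z : lmodule A)
    (g : lmod_hom W Z) (f : lmod_hom V W) v : lmod_comp g f v = g (f v).
Proof. exact: comp_lfunE. Qed.

Lemma lmod_idE (K : fieldType) (A : falgType K) (V : lmodule A) (v : V) :
  lmod_id V v = v.
Proof. exact: id_lfunE. Qed.

Lemma qproj_mor (K : fieldType) (A : falgType K) (U : bimodule A)
    (W : {vspace U}) (subW : is_subbimod W) :
  bimod_mor (linfun (qproj W) : 'Hom(U, quot_bimod subW)).
Proof.
split=> a u; rewrite !lfunE.
  by rewrite /= /quot_lact qmapE //; apply: subW.1.
pose R : {linear U -> U} := HB.pack (fun u : U => ract u a)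
  (GRing.isLinear.Build K U U _ _ (@ract_linl _ _ U a)).
by rewrite /= /quot_ract (@qmapE _ _ _ _ _ R) //; apply: subW.2.
Qed.

Definition pure (K : fieldType) (A : falgType K) (U : bimodule A)
    (V : lmodule A) (u : U) (v : V) : tensA U V :=
  qproj (tens_rel U V) (tens u v).

Local Notation "u \ox v" := (pure u v) (at level 40, left associativity).

Section PureTensors.
Variables (K : fieldType) (A : falgType K) (U : bimodule A).

Lemma pure_linl (V : lmodule A) (v : V) : linear (fun u : U => u \ox v).
Proof. by move=> c u u'; rewrite /pure tens_linl linearP. Qed.

Lemma pure_linr (V : lmodule A) (u : U) : linear (fun v : V => u \ox v).
Proof. by move=> c v v'; rewrite /pure tens_linr linearP. Qed.

Lemma pure_bal (V : lmodule A) (u : U) a (v : V) :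
  ract u a \ox v = u \ox lm_act a v.
Proof.
by apply/eqP; rewrite -subr_eq0 /pure -linearB qproj_eq0 tens_relP.
Qed.

Lemma pure_act (V : lmodule A) a (u : U) (v : V) :
  lm_act a (u \ox v) = lact a u \ox v.
Proof.
rewrite /pure /= /tensA_act qmapE; last exact: tmapl_rel.
by congr qproj; exact: (tmapE (lact a) idfun).
Qed.

Lemma pure_map (V W : lmodule A) (f : lmod_hom V W) (u : U) (v : V) :
  tensA_hom U f (u \ox v) = u \ox f v.
Proof.
rewrite /= tensA_lfunE /pure qmapE; last exact: tmapr_rel.
by congr qproj; exact: (tmapE idfun f).
Qed.

Lemma tensK_sum (V : lmodule A) (t : tensK U V) :
  t = \sum_i \sum_j t i j *: tens (r2v (delta_mx 0 i)) (r2v (delta_mx 0 j)).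
Proof.
rewrite {1}[t]matrix_sum_delta; apply: eq_bigr => i _; apply: eq_bigr => j _.
by rewrite /tens !r2vK trmx_delta mul_delta_mx.
Qed.

Lemma pure_ext (V : lmodule A) (X : vectType K)
    (g h : {linear tensA U V -> X}) :
  (forall u v, g (u \ox v) = h (u \ox v)) -> g =1 h.
Proof.
move=> gh t; rewrite -[t]qliftK (tensK_sum (qlift t)) !linear_sum.
apply: eq_bigr => i _; rewrite !linear_sum; apply: eq_bigr => j _.
by rewrite !linearZ; congr (_ *: _); apply: gh.
Qed.

Lemma pure_hom_ext (V X : lmodule A) (g h : lmod_hom (tensA U V) X) :
  (forall u v, g (u \ox v) = h (u \ox v)) -> g = h.
Proof. by move=> gh; apply/lmod_hom_ext/pure_ext. Qed.

(** The universal property of [U (x)_A V] for linear maps.  On [U (x)_K V],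
    which is a space of matrices, the map is given by the values of [f] on
    pairs of basis vectors; it kills the relations because [f] is balanced. *)
Lemma tens_lift (V : lmodule A) (X : vectType K) (f : U -> V -> X) :
    (forall v, linear (f^~ v)) -> (forall u, linear (f u)) ->
    (forall u a v, f (ract u a) v = f u (lm_act a v)) ->
  exists g : 'Hom(tensA U V, X), forall u v, g (u \ox v) = f u v.
Proof.
move=> fl fr fb.
pose g0 (t : tensK U V) :=
  \sum_i \sum_j t i j *: f (r2v (delta_mx 0 i)) (r2v (delta_mx 0 j)).
have g0l : linear g0.
  move=> c s t; rewrite /g0 scaler_sumr -big_split; apply: eq_bigr => i _ /=.
  rewrite scaler_sumr -big_split; apply: eq_bigr => j _ /=.
  by rewrite !mxE scalerDl scalerA.
pose g1 : {linear tensK U V -> X} :=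
  HB.pack g0 (GRing.isLinear.Build K _ _ _ _ g0l).
have lin (Y : vectType K) (h : Y -> X) (y : Y) : linear h ->
    h y = \sum_i v2r y 0 i *: h (r2v (delta_mx 0 i)).
  move=> hl; pose H : {linear Y -> X} :=
    HB.pack h (GRing.isLinear.Build K _ _ _ _ hl).
  rewrite -[y in LHS]v2rK [in LHS](row_sum_delta (v2r y)) -[h]/(H : _ -> _).
  by rewrite !linear_sum; apply: eq_bigr => i _; rewrite !linearZ.
have g0E u v : g0 (tens u v) = f u v.
  rewrite (lin _ _ u (fl v)); apply: eq_bigr => i _.
  rewrite (lin _ _ v (fr _)) scaler_sumr; apply: eq_bigr => j _.
  by rewrite scalerA /tens mxE big_ord1 !mxE.
have g1rel w : w \in tens_rel U V -> g1 w = 0.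
  move=> wW; apply/eqP; rewrite -memv0; move: w wW; apply: tens_rel_ind.
  by move=> u a v; rewrite linearB /= !g0E fb subrr mem0v.
exists (linfun (g1 \o @qlift _ _ _)) => u v; rewrite lfunE /= -g0E.
apply/eqP; rewrite -subr_eq0 -[g0]/(g1 : _ -> _) -linearB; apply/eqP/g1rel.
exact: qprojK.
Qed.

Lemma tens_lift_hom (V X : lmodule A) (f : U -> V -> X) :
    (forall v, linear (f^~ v)) -> (forall u, linear (f u)) ->
    (forall u a v, f (ract u a) v = f u (lm_act a v)) ->
    (forall a u v, f (lact a u) v = lm_act a (f u v)) ->
  exists g : lmod_hom (tensA U V) X, forall u v, g (u \ox v) = f u v.
Proof.
move=> fl fr fb fa; have [g gE] := tens_lift fl fr fb.
have gP a t : g (lm_act a t) = lm_act a (g t).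
  apply: (pure_ext (g := g \o lm_act a) (h := lm_act a \o g)) => u v.
  rewrite -[LHS]/(g (lm_act a (u \ox v))) -[RHS]/(lm_act a (g (u \ox v))).
  by rewrite pure_act !gE fa.
by exists (LmodHom gP).
Qed.

(** The pure tensors [u (x) e] form a subspace, which contains all
    [u (x) a e = u a (x) e]. *)
Lemma cyclic_pure (V : lmodule A) (e : V) (t : tensA U V) :
  (forall v : V, exists a, v = lm_act a e) -> exists u : U, t = u \ox e.
Proof.
move=> gen; pose L : {linear U -> tensA U V} :=
  HB.pack (fun u => u \ox e) (GRing.isLinear.Build K _ _ _ _ (pure_linl e)).
have LE u : linfun L u = u \ox e by exact: lfunE.
suff : t \in limg (linfun L) by case/memv_imgP=> u _ ->; exists u.
rewrite -qproj_eq0; apply/eqP; move: t.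
apply: (@pure_ext V (quotv (limg (linfun L))) (qproj _) \0) => u v.
have [a ->] := gen v.
apply/eqP; rewrite [X in _ == X]/(0) qproj_eq0 -pure_bal -LE.
exact/memv_img/memvf.
Qed.

End PureTensors.

Section BimoduleQuotient.
Variables (K : fieldType) (A : falgType K) (U F : bimodule A).
Variables (p : 'Hom(U, F)) (s : F -> U).
Hypotheses (pP : bimod_mor p) (sK : cancel s p).

Lemma tens_surj_ext (V X : lmodule A) (g h : lmod_hom (tensA F V) X) :
  (forall u v, g (p u \ox v) = h (p u \ox v)) -> g = h.
Proof. by move=> gh; apply: pure_hom_ext => t v; rewrite -[t]sK gh. Qed.

Lemma tens_surj_pull (V X : lmodule A) (f : lmod_hom (tensA F V) X) :
  exists f' : lmod_hom (tensA U V) X, forall u v, f' (u \ox v) = f (p u \ox v).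
Proof.
apply: (tens_lift_hom (f := fun u v => f (p u \ox v))).
- by move=> v c u u'; rewrite linearP pure_linl linearP.
- by move=> u c v v'; rewrite pure_linr linearP.
- by move=> u a v; rewrite pP.2 pure_bal.
- by move=> a u v; rewrite pP.1 -pure_act lmod_funP.
Qed.

Lemma tens_surj_factor (V X : lmodule A) (h : lmod_hom (tensA U V) X) :
    (forall u (v : V), p u = 0 -> h (u \ox v) = 0) ->
  exists g : lmod_hom (tensA F V) X,
    forall u (v : V), g (p u \ox v) = h (u \ox v).
Proof.
have [pl pr] := pP => h0.
pose f (t : F) (v : V) := h (s t \ox v).
have fE u v : f (p u) v = h (u \ox v).
  have e0 : h ((u - s (p u)) \ox v) = 0.
    by apply: h0; rewrite linearB /= sK subrr.
  have e : s (p u) = (-1) *: (u - s (p u)) + u by rewrite scaleN1r opprB subrK.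
  by rewrite /f e pure_linl linearP /= e0 scaler0 add0r.
have [||t a v|a t v|g gE] := @tens_lift_hom _ _ F V X f.
- move=> v c t t'; rewrite -[t]sK -[t']sK -linearP !fE pure_linl.
  exact: linearP.
- by move=> t c v v'; rewrite /f pure_linr linearP.
- by rewrite -[t]sK -pr !fE pure_bal.
- by rewrite -[t]sK -pl !fE -lmod_funP pure_act.
by exists g => u v; rewrite gE fE.
Qed.

End BimoduleQuotient.

(** * Modules over the dual numbers *)

Section DualNumbers.
Variable K : fieldType.
Local Notation D := (dual_num K).
Local Notation x := (dn_x K).

Lemma dn_decomp (d : D) : d = dn_re d *: (1 : D) + dn_eps d *: x.
Proof.
apply/val_inj/polyP => i /=.
rewrite coefD !coefZ (dn_x_coef K) /=.
have [->|[->|ige]] : i = 0%N \/ i = 1%N \/ (2 <= i)%N.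
- by case: i => [|[|i]]; [left | right; left | right; right].
- by rewrite coefC eqxx /= mulr1 mulr0 addr0.
- by rewrite coefC /= mulr0 mulr1 add0r.
rewrite coefC !gtn_eqF //=; last exact: ltnW.
rewrite !mulr0 addr0.
by apply: big_coef_npoly; rewrite mk_monic_Xn size_polyXn; exact: ige.
Qed.

Lemma dn_xx : x * x = 0 :> D.
Proof.
rewrite [x * x]dn_decomp dn_reM dn_epsM /dn_re /dn_eps !dn_x_coef /=.
by rewrite !(mul0r, mulr0) addr0 !scale0r addr0.
Qed.

Lemma lm_act0 (V : lmodule D) (v : V) : lm_act 0 v = 0.
Proof. exact: (linear_fun0 (lm_act_linl v)). Qed.

Lemma lm_act_xx (V : lmodule D) (v : V) : lm_act x (lm_act x v) = 0.
Proof. by rewrite -lm_actM dn_xx lm_act0. Qed.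

Lemma lm_actE (V : lmodule D) (d : D) (v : V) :
  lm_act d v = dn_re d *: v + dn_eps d *: lm_act x v.
Proof.
rewrite {1}[d]dn_decomp lm_act_linl lm_act1; congr (_ + _).
by have := lm_act_linl v (dn_eps d) x 0; rewrite lm_act0 !addr0.
Qed.

End DualNumbers.

(** * Maps out of string bimodules *)

Section Strings.
Variables (K : fieldType) (k : nat).
Local Notation D := (dual_num K).
Local Notation x := (dn_x K).
Local Notation M := (M_ K k).
Local Notation m_last := (m_ K k (2 * k + 3) : M).

Lemma string_lactE (d : D) (u : M) :
  lact d u = dn_re d *: u + dn_eps d *: lact x u.
Proof.
by rewrite /= /dn_act /dn_re /dn_eps !dn_x_coef scale0r add0r scale1r.
Qed.

Lemma string_ractE (d : D) (u : M) :
  ract u d = dn_re d *: u + dn_eps d *: ract u x.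
Proof.
by rewrite /= /dn_act /dn_re /dn_eps !dn_x_coef scale0r add0r scale1r.
Qed.

Lemma string_ext (X : lmodType K) (g h : M -> X) :
  linear g -> linear h ->
  (forall r, (0 < r <= 2 * k + 3)%N -> g (m_ K k r) = h (m_ K k r)) -> g =1 h.
Proof.
move=> gl hl gh u.
pose G : {linear M -> X} := HB.pack g (GRing.isLinear.Build K _ _ _ _ gl).
pose H : {linear M -> X} := HB.pack h (GRing.isLinear.Build K _ _ _ _ hl).
have -> : u = \sum_(j < 2 * k + 3) u 0 j *: m_ K k j.+1 :> M.
  rewrite [u in LHS]row_sum_delta; apply: eq_bigr => j _; congr (_ *: _).
  by apply/rowP => i; rewrite !mxE eqSS eqxx.
rewrite -[g]/(G : _ -> _) -[h]/(H : _ -> _) !linear_sum; apply: eq_bigr => j _.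
by rewrite !linearZ; congr (_ *: _); apply: gh; rewrite /= ltn_ord.
Qed.

(** The generator [t_i]; it is a basis vector for [i <= k] only. *)
Definition top_ (i : nat) : M := m_ K k (2 * i + 2).
Local Notation t_ := top_.

Lemma string_indexP (r : nat) : (0 < r <= 2 * k + 3)%N ->
  [\/ r = 1%N, exists2 i, (i <= k)%N & r = (2 * i + 2)%N |
      exists2 i, (i <= k)%N & r = (2 * i + 3)%N].
Proof.
move=> rk; have [->|r1] := eqVneq r 1%N; first by constructor 1.
have [or|er] := boolP (odd r); [constructor 3; exists (r./2.-1) |
  constructor 2; exists (r./2.-1)]; lia.
Qed.

Lemma m_odd_kill (i : nat) (im : (i <= k.+1)%N) :
  lact x (m_ K k (2 * i + 1) : M) = 0 /\ ract (m_ K k (2 * i + 1) : M) x = 0.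
Proof.
have rk : (0 < 2 * i + 1 <= 2 * k + 3)%N by lia.
by rewrite (m_xl K rk) (m_xr K rk); have -> : odd (2 * i + 1) by lia.
Qed.

Lemma top_xl i : (i <= k)%N -> lact x (t_ i) = m_ K k (2 * i + 3).
Proof.
move=> ik; rewrite /t_ m_xl; last lia.
have -> : odd (2 * i + 2) = false by lia.
by rewrite -addnS.
Qed.

Lemma top_xr i : (i <= k)%N -> ract (t_ i) x = m_ K k (2 * i + 1).
Proof.
move=> ik; rewrite /t_ m_xr; last lia.
have -> : odd (2 * i + 2) = false by lia.
by congr m_; lia.
Qed.

Lemma top_link i : (i < k)%N -> lact x (t_ i) = ract (t_ i.+1) x.
Proof.
move=> ik; rewrite top_xl; last exact: ltnW.
by rewrite top_xr //; congr m_; lia.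
Qed.

(** The relations [x t_i = t_(i+1) x] translated to the images
    [b i v] of [t_i (x) v] under a module map [M_k (x) V -> X]. *)
Definition chain (V X : lmodule D) (b : nat -> V -> X) : Prop :=
  (forall i, linear (b i)) /\
  forall i v, (i < k)%N -> lm_act x (b i v) = b i.+1 (lm_act x v).

(** The image of [m_r (x) v] that is forced by those of the [t_i (x) v]: for
    odd [r > 1] it comes from [m_r = x t_i], while [m_1 = t_0 x]. *)
Definition string_val (V X : lmodule D) (b : nat -> V -> X) (r : nat) (v : V) :
    X :=
  if odd r then if r./2 is i.+1 then lm_act x (b i v) else b 0 (lm_act x v)
  else b r./2.-1 v.

Section StringValues.
Variables (V X : lmodule D) (b : nat -> V -> X) (v : V).

Lemma string_val1 : string_val b 1 v = b 0 (lm_act x v).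
Proof. by []. Qed.

Lemma string_val_top i : string_val b (2 * i + 2) v = b i v.
Proof.
rewrite /string_val; have -> : odd (2 * i + 2) = false by lia.
by have -> : (2 * i + 2)./2.-1 = i by lia.
Qed.

Lemma string_val_soc i : string_val b (2 * i + 3) v = lm_act x (b i v).
Proof.
rewrite /string_val; have -> : odd (2 * i + 3) by lia.
by have -> : (2 * i + 3)./2 = i.+1 by lia.
Qed.

End StringValues.

(** The map must also respect that [x] kills the odd basis vectors on both
    sides, that is [x t_i x = 0].  This is a consequence of the links: they move
    one [x] to the side of the other, and [x^2 = 0].  Every [t_i] takes part in
    a link because [k > 0]. *)
Lemma string_lift (V X : lmodule D) (b : nat -> V -> X) :
    (0 < k)%N -> chain b ->
  exists h : lmod_hom (tensA M V) X,
    forall i v, (i <= k)%N -> h (t_ i \ox v) = b i v.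
Proof.
move=> k_gt0 [bl bx].
pose g := string_val b.
pose f (u : M) (v : V) := \sum_(j < 2 * k + 3) u 0 j *: g j.+1 v.
have b0 i : b i 0 = 0 by exact: linear_fun0 (bl i).
have gl r : linear (g r).
  move=> c v v'; rewrite /g /string_val.
  by case: odd; rewrite ?bl //; case: r./2 => [|i]; rewrite ?bl !lm_act_linr ?bl.
have fl v : linear (f^~ v).
  move=> c u u'; rewrite /f scaler_sumr -big_split; apply: eq_bigr => j _ /=.
  by rewrite !mxE scalerDl scalerA.
have fr u : linear (f u).
  move=> c v v'; rewrite /f scaler_sumr -big_split; apply: eq_bigr => j _ /=.
  by rewrite gl scalerDr !scalerA mulrC.
have fm r v : (0 < r <= 2 * k + 3)%N -> f (m_ K k r) v = g r v.
  case: r => // r rlt; rewrite /f (bigD1 (Ordinal rlt)) //= big1 ?addr0.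
    by rewrite mxE eqxx scale1r.
  move=> j /negPf jr.
  by rewrite mxE eqSS -[_ == r]/(j == Ordinal rlt) jr scale0r.
have f0 v : f 0 v = 0 by exact: linear_fun0 (fl v).
have gr r v : (0 < r <= 2 * k + 3)%N ->
    f (ract (m_ K k r : M) x) v = g r (lm_act x v).
  case/string_indexP=> [->|[i ik ->]|[i ik ->]].
  - rewrite -[1%N]/(2 * 0 + 1)%N (m_odd_kill _).2 // f0 /g.
    by rewrite string_val1 lm_act_xx b0.
  - rewrite -/(t_ i) top_xr // fm /g; last lia.
    rewrite string_val_top; case: i ik => [|i] ik; first by rewrite string_val1.
    by rewrite -bx // -string_val_soc; congr (string_val _ _ _); lia.
  have e : (2 * i + 3 = 2 * i.+1 + 1)%N by lia.
  rewrite {1}e (m_odd_kill _).2 // f0 /g string_val_soc.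
  have [ilt|kle] := ltnP i k; first by rewrite bx // lm_act_xx b0.
  (* Here i = k: use the link that ends at [t_k] instead of one that starts
     there. *)
  have -> : i = k.-1.+1 by lia.
  by rewrite -bx ?lm_act_xx //; lia.
have gL r v : (0 < r <= 2 * k + 3)%N ->
    f (lact x (m_ K k r : M)) v = lm_act x (g r v).
  case/string_indexP=> [->|[i ik ->]|[i ik ->]].
  - rewrite -[1%N]/(2 * 0 + 1)%N (m_odd_kill _).1 // f0 /g.
    by rewrite string_val1 bx // lm_act_xx b0.
  - by rewrite -/(t_ i) top_xl // fm /g ?string_val_soc ?string_val_top //; lia.
  have e : (2 * i + 3 = 2 * i.+1 + 1)%N by lia.
  by rewrite {1}e (m_odd_kill _).1 // f0 /g string_val_soc lm_act_xx.
have flZ v c u u' : f (c *: u + u') v = c *: f u v + f u' v by exact: fl.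
have frZ u c v v' : f u (c *: v + v') = c *: f u v + f u v' by exact: fr.
have fbx u v : f (ract u x) v = f u (lm_act x v).
  move: u; apply: (@string_ext _ (fun u => f (ract u x) v)
    (fun u => f u (lm_act x v))) => [c u1 u2|c u1 u2|r rk].
  - by rewrite ract_linl flZ.
  - by rewrite flZ.
  - by rewrite gr // fm.
have fLx u v : f (lact x u) v = lm_act x (f u v).
  move: u; apply: (@string_ext _ (fun u => f (lact x u) v)
    (fun u => lm_act x (f u v))) => [c u1 u2|c u1 u2|r rk].
  - by rewrite lact_linr flZ.
  - by rewrite flZ lm_act_linr.
  - by rewrite gL // fm.
have fZ c u v : f (c *: u) v = c *: f u v.
  by rewrite -[c *: u]addr0 flZ f0 addr0.
have [u a v|a u v|h hE] := tens_lift_hom fl fr.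
- rewrite string_ractE lm_actE flZ frZ fZ fbx; congr (_ + _).
  by rewrite -[dn_eps a *: lm_act _ _]addr0 frZ (linear_fun0 (fr u)) addr0.
- by rewrite string_lactE flZ fZ fLx [RHS]lm_actE.
exists h => i v ik; rewrite hE fm; last lia.
exact: string_val_top.
Qed.

Lemma string_hom_last (V X : lmodule D) (h : lmod_hom (tensA M V) X) (v : V) :
  h (m_last \ox v) = lm_act x (h (t_ k \ox v)).
Proof. by rewrite -top_xl // -pure_act lmod_funP. Qed.

Lemma string_hom_ext (V X : lmodule D) (g h : lmod_hom (tensA M V) X) :
  (forall i v, (i <= k)%N -> g (t_ i \ox v) = h (t_ i \ox v)) -> g = h.
Proof.
move=> gh; apply: pure_hom_ext => u v.
move: u; apply: (@string_ext _ (fun u => g (u \ox v)) (fun u => h (u \ox v))).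
- by move=> c u u'; rewrite pure_linl linearP.
- by move=> c u u'; rewrite pure_linl linearP.
move=> r; case/string_indexP=> [->|[i ik ->]|[i ik ->]]; last 1 first.
- by rewrite -top_xl // -!pure_act !lmod_funP gh.
- by rewrite -[1%N]/(2 * 0 + 1)%N -top_xr // !pure_bal gh.
exact: gh.
Qed.

Hypothesis k_gt0 : (0 < k)%N.

(** The bimodules [M_k] and [N_k] are treated together, as quotients [F] of
    [M_k] by a subspace of the line spanned by the last basis vector. *)
Section StringQuotient.
Variables (F : bimodule D) (p : 'Hom(M, F)) (s : F -> M).
Hypotheses (pP : bimod_mor p) (sK : cancel s p).
Hypothesis kerp : forall u, p u = 0 -> u \in <[m_last]>%VS.

Lemma string_quot_ext (V X : lmodule D) (g h : lmod_hom (tensA F V) X) :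
  (forall i v, (i <= k)%N -> g (p (t_ i) \ox v) = h (p (t_ i) \ox v)) ->
  g = h.
Proof.
move=> gh; apply: (tens_surj_ext sK) => u v.
have [g' g'E] := tens_surj_pull pP g; have [h' h'E] := tens_surj_pull pP h.
have e : g' = h' by apply: string_hom_ext => i v' ik; rewrite g'E h'E gh.
by rewrite -g'E -h'E e.
Qed.

Lemma string_quot_lift (V X : lmodule D) (b : nat -> V -> X) :
    chain b -> (p m_last = 0 -> forall v, lm_act x (b k v) = 0) ->
  exists h : lmod_hom (tensA F V) X,
    forall i v, (i <= k)%N -> h (p (t_ i) \ox v) = b i v.
Proof.
move=> bP b_last; have [h hE] := string_lift k_gt0 bP.
have [|g gE] := tens_surj_factor (h := h) pP sK.
  move=> u v pu0; have /vlineP[c uE] := kerp pu0.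
  have [c0|c0] := eqVneq c 0.
    by rewrite uE c0 scale0r (linear_fun0 (pure_linl v)) linear0.
  rewrite uE -[c *: _]addr0 pure_linl (linear_fun0 (pure_linl v)) addr0 linearZ.
  rewrite /= string_hom_last hE // b_last ?scaler0 //.
  by apply/eqP; move/eqP: pu0; rewrite uE linearZ scaler_eq0 (negPf c0).
by exists g => i v ik; rewrite gE hE.
Qed.

Lemma string_quot_nat (C : category) (E T : functor C (lmod_cat D))
    (b : forall X : C, nat -> E X -> T X) :
    (forall X, chain (b X)) ->
    (p m_last = 0 -> forall X v, lm_act x (b X k v) = 0) ->
    (forall X Y (f : hom X Y) i v, (fmap T f : lmod_hom _ _) (b X i v) =
       b Y i ((fmap E f : lmod_hom _ _) v)) ->
  exists theta : nat_trans (compF (tensF F) E) T,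
    forall X i v, (i <= k)%N ->
      (theta X : lmod_hom _ _) (p (t_ i) \ox v) = b X i v.
Proof.
move=> bP b_last bN.
have thE X := cid (string_quot_lift (bP X) (b_last ^~ X)).
pose th X := projT1 (thE X).
have thP X i v : (i <= k)%N -> th X (p (t_ i) \ox v) = b X i v.
  by move=> ik; apply: (projT2 (thE X)).
suff thN X Y (f : hom X Y) : comp (th Y : hom (compF (tensF F) E Y) (T Y))
    (fmap (compF (tensF F) E) f) = comp (fmap T f) (th X).
  by exists (NatTrans (F := compF (tensF F) E) thN).
apply: string_quot_ext => i v ik.
rewrite /= !comp_lfunE /= thP // bN.
by rewrite -[X in th Y X]/(tensA_hom F (fmap E f) _) pure_map thP.
Qed.

End StringQuotient.

Lemma string_nat (C : category) (E T : functor C (lmod_cat D))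
    (b : forall X : C, nat -> E X -> T X) :
    (forall X, chain (b X)) ->
    (forall X Y (f : hom X Y) i v, (fmap T f : lmod_hom _ _) (b X i v) =
       b Y i ((fmap E f : lmod_hom _ _) v)) ->
  exists theta : nat_trans (compF (tensF M) E) T,
    forall X i v, (i <= k)%N -> (theta X : lmod_hom _ _) (t_ i \ox v) = b X i v.
Proof.
move=> bP bN.
have idP : bimod_mor (\1%VF : 'Hom(M, M)) by split=> a u; rewrite !id_lfunE.
have idK : cancel id (\1%VF : 'Hom(M, M)) by move=> u; rewrite id_lfunE.
have [u|m0 X v|theta thE] := string_quot_nat idP idK _ bP _ bN.
- by rewrite id_lfunE => ->; rewrite mem0v.
- rewrite id_lfunE in m0; move/rowP: m0.
  have last_lt : (2 * k + 2 < 2 * k + 3)%N by lia.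
  move/(_ (Ordinal last_lt)); rewrite !mxE /= -addnS eqxx => /eqP.
  by rewrite oner_eq0.
by exists theta => X i v ik; rewrite -thE // id_lfunE.
Qed.

(** * The counit and the diagonal *)

Section Counit.
Variables (C : category) (E : functor C (lmod_cat D)).

Lemma counit_exists :
  exists eps : nat_trans (compF (tensF M) E) E,
    forall X i v, (i <= k)%N -> (eps X : lmod_hom _ _) (t_ i \ox v) = v.
Proof. by apply: (@string_nat _ E E (fun X i v => v)). Qed.

Lemma diagonal_shift (F : bimodule D) (p : 'Hom(M, F)) (V : lmodule D) i
    (v : V) : bimod_mor p -> (i < k)%N ->
  lm_act x (p (t_ i) \ox (t_ i \ox v)) =
  p (t_ i.+1) \ox (t_ i.+1 \ox lm_act x v).
Proof.
move=> [pl pr] ik; have e := top_link ik.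
by rewrite pure_act -pl e pr pure_bal pure_act e pure_bal.
Qed.

(** The diagonal [t_i |-> t_i (x) t_i] passes to the quotient [F] of [M_k]
    because it sends the last basis vector [x t_k] to [x t_k (x) t_k]. *)
Lemma diagonal_exists (F : bimodule D) (p : 'Hom(M, F)) (s : F -> M)
    (eps : nat_trans (compF (tensF M) E) E) :
    bimod_mor p -> cancel s p ->
    (forall u, p u = 0 -> u \in <[m_last]>%VS) ->
    (forall X i v, (i <= k)%N -> (eps X : lmod_hom _ _) (t_ i \ox v) = v) ->
  exists xi : nat_trans (compF (tensF F) E)
                        (compF (tensF F) (compF (tensF M) E)),
    forall X, lmod_comp (tensA_hom F (eps X)) (xi X) = lmod_id (tensA F (E X)).
Proof.
move=> pP sK kerp epsE.
pose b (X : C) i (v : E X) : tensA F (tensA M (E X)) :=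
  p (t_ i) \ox (t_ i \ox v).
have [X|p0 X v|X Y f i v|xi xiE] := string_quot_nat (E := E)
    (T := compF (tensF F) (compF (tensF M) E)) (b := b) pP sK kerp.
- split=> [i c v v'|i v ik]; first by rewrite /b !pure_linr.
  exact: (@diagonal_shift F p (E X) i v pP ik).
- rewrite /b pure_act -pP.1 top_xl // p0.
  by rewrite (linear_fun0 (pure_linl _)).
- rewrite -[LHS]/(tensA_hom F (tensA_hom M (fmap E f)) _) /b.
  by rewrite [LHS]pure_map pure_map.
exists xi => X; apply: (string_quot_ext pP sK) => i v ik.
by rewrite lmod_compE xiE // lmod_idE pure_map epsE.
Qed.

End Counit.

(** * Reading off coefficients *)

(** The coefficient of [m_r]; it is 0 for [r] out of range, in particular for
    [r = 0]. *)
Definition coef (r : nat) (u : M) : K :=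
  \sum_(j < 2 * k + 3 | j.+1 == r :> nat) u 0 j.

Lemma coef_linear r : linear (coef r : M -> K^o).
Proof.
move=> c u v; rewrite /coef scaler_sumr -big_split; apply: eq_bigr => j _.
by rewrite !mxE.
Qed.

Lemma coef_m r r' : (0 < r' <= 2 * k + 3)%N ->
  coef r (m_ K k r') = (r == r')%:R.
Proof.
case: r' => // j jk; rewrite /coef; have [->|ne] := eqVneq r j.+1.
  by rewrite (big_pred1 (Ordinal jk)) ?mxE //= ?eqxx.
by apply: big1 => i /eqP ir; rewrite mxE ir (negPf ne).
Qed.

Lemma coef_comp (f : M -> M) (a b : nat) : linear f ->
    (forall r, (0 < r <= 2 * k + 3)%N ->
       coef a (f (m_ K k r)) = (b == r)%:R) ->
  forall u, coef a (f u) = coef b u.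
Proof.
move=> fl fE; apply: (@string_ext K^o (fun u => coef a (f u))).
- by move=> c u u'; rewrite fl coef_linear.
- exact: coef_linear.
- by move=> r rk; rewrite fE // coef_m.
Qed.

Lemma coef0 u : coef 0 u = 0.
Proof. exact: big_pred0. Qed.

Lemma coef_xl_odd i u : coef (2 * i + 3) (lact x u) = coef (2 * i + 2) u.
Proof.
move: u; apply: coef_comp => [|r rk]; first exact: lact_linr.
rewrite m_xl //; case: ifPn => odd_r.
  by rewrite (linear_fun0 (coef_linear _)) (_ : _ == r = false) //; lia.
by rewrite coef_m; [congr (nat_of_bool _)%:R | ]; lia.
Qed.

Lemma coef_xl_even i u : coef (2 * i + 2) (lact x u) = 0.
Proof.
rewrite -[RHS](coef0 u); move: u.
apply: coef_comp => [|r rk]; first exact: lact_linr.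
rewrite m_xl //; case: ifPn => odd_r.
  by rewrite (linear_fun0 (coef_linear _)) (_ : _ == r = false) //; lia.
by rewrite coef_m; [congr (nat_of_bool _)%:R | ]; lia.
Qed.

Lemma coef_xr_odd i u : coef (2 * i + 1) (ract u x) = coef (2 * i + 2) u.
Proof.
move: u; apply: coef_comp => [|r rk]; first exact: ract_linl.
rewrite m_xr //; case: ifPn => odd_r.
  by rewrite (linear_fun0 (coef_linear _)) (_ : _ == r = false) //; lia.
by rewrite coef_m; [congr (nat_of_bool _)%:R | ]; lia.
Qed.

Lemma coef_xr_even i u : coef (2 * i + 2) (ract u x) = 0.
Proof.
rewrite -[RHS](coef0 u); move: u.
apply: coef_comp => [|r rk]; first exact: ract_linl.
rewrite m_xr //; case: ifPn => odd_r.
  by rewrite (linear_fun0 (coef_linear _)) (_ : _ == r = false) //; lia.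
by rewrite coef_m; [congr (nat_of_bool _)%:R | ]; lia.
Qed.

(** [P] takes the coefficient in [W] of [t_i]: it is induced by the right module
    map [M_k -> D] with [t_i |-> 1], hence [m_(2i+1) = t_i x |-> x], that sends
    the other basis vectors to 0. *)
Definition reads_top (i : nat) (W : lmodule D) (P : 'Hom(tensA M W, W)) :=
  forall u w,
    P (u \ox w) = coef (2 * i + 2) u *: w + coef (2 * i + 1) u *: lm_act x w.

Lemma reads_top_exists (i : nat) (W : lmodule D) : exists P, @reads_top i W P.
Proof.
pose f (u : M) (w : W) :=
  coef (2 * i + 2) u *: w + coef (2 * i + 1) u *: lm_act x w.
have fl w : linear (f^~ w).
  move=> c u u'; rewrite /f !coef_linear !scalerDl scalerDr !scalerA.
  by rewrite addrACA.
have fr u : linear (f u).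
  move=> c w w'; rewrite /f lm_act_linr !scalerDr !scalerA !(mulrC c).
  by rewrite addrACA.
have frZ u c w w' : f u (c *: w + w') = c *: f u w + f u w' by exact: fr.
have flZ w c u u' : f (c *: u + u') w = c *: f u w + f u' w by exact: fl.
have fx u w : f (ract u x) w = f u (lm_act x w).
  rewrite /f coef_xr_odd coef_xr_even lm_act_xx scaler0 scale0r addr0.
  by rewrite add0r.
apply: (tens_lift fl fr) => u a w.
rewrite string_ractE lm_actE flZ frZ; congr (_ + _).
rewrite -[dn_eps a *: ract _ _]addr0 flZ -[dn_eps a *: lm_act _ _]addr0 frZ fx.
by rewrite (linear_fun0 (fl w)) (linear_fun0 (fr u)).
Qed.

Lemma reads_top_nat i (V W : lmodule D) (P : 'Hom(tensA M V, V))
    (Q : 'Hom(tensA M W, W)) (g : lmod_hom V W) t :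
  reads_top i P -> reads_top i Q -> Q (tensA_hom M g t) = g (P t).
Proof.
move=> PE QE; move: t.
apply: (pure_ext (g := Q \o tensA_hom M g) (h := g \o P)) => u v.
rewrite -[LHS]/(Q (tensA_hom M g (u \ox v))) -[RHS]/(g (P (u \ox v))).
by rewrite pure_map QE PE linearP linearZ /= -lmod_funP.
Qed.

(** Both sides take [t_i (x) w] to [x w], since [x t_i = t_(i+1) x], and kill
    the other [m_r (x) w]. *)
Lemma reads_top_shift i (W : lmodule D) (P Q : 'Hom(tensA M W, W)) t :
  reads_top i P -> reads_top i.+1 Q -> Q (lm_act x t) = lm_act x (P t).
Proof.
move=> PE QE; move: t.
apply: (pure_ext (g := Q \o lm_act x) (h := lm_act x \o P)) => u w.
rewrite -[LHS]/(Q (lm_act x (u \ox w))) -[RHS]/(lm_act x (P (u \ox w))).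
have e : (2 * i.+1 + 1 = 2 * i + 3)%N by lia.
rewrite pure_act QE PE e coef_xl_odd coef_xl_even scale0r add0r.
by rewrite lm_act_linr linearZ /= lm_act_xx scaler0 addr0.
Qed.

(** * Factoring the counit *)

(** For an equivalence [E] this says that [e0] is a basis of the D-module
    [E X0]: the first part is generation, and the second gives freeness. *)
Definition free_on (C : category) (E : functor C (lmod_cat D)) (X0 : C)
    (e0 : E X0 : lmodule D) : Prop :=
  (forall v : (E X0 : lmodule D), exists a, v = lm_act a e0) /\
  (forall X (v : (E X : lmodule D)),
     exists f : hom X0 X, (fmap E f : lmod_hom _ _) e0 = v).

(** The sequence [u_i] of elements of [U] that defines [beta] is read off from
    [xi (t_i (x) e0)], whose coefficient of [t_i] is [u_i (x) e0].  The links
    and the values of [phi] on these elements are first proved at [e0], then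
    moved to any [v] in [E X] along a map that sends [e0] to [v]. *)
Lemma counit_represents (C : category) (E : functor C (lmod_cat D))
    (U : bimodule D) (X0 : C) (e0 : E X0 : lmodule D)
    (eps : nat_trans (compF (tensF M) E) E)
    (phi : nat_trans (compF (tensF U) E) E)
    (xi : nat_trans (compF (tensF M) E) (compF (tensF M) (compF (tensF U) E))) :
    free_on e0 ->
    (forall X i v, (i <= k)%N -> (eps X : lmod_hom _ _) (t_ i \ox v) = v) ->
    (forall X,
       lmod_comp (tensA_hom M (phi X)) (xi X) = lmod_id (tensA M (E X))) ->
  exists beta : nat_trans (compF (tensF M) E) (compF (tensF U) E),
    nt_eq eps (vcomp phi beta).
Proof.
move=> [gen lift] epsE split_xi.
pose W := tensA U (E X0).
have [P PE] := choice (fun i => @reads_top_exists i W).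
have [Q QE] := choice (fun i => @reads_top_exists i (E X0)).
pose xi0 : lmod_hom (tensA M (E X0)) (tensA M W) := xi X0.
pose phi0 : lmod_hom W (E X0) := phi X0.
pose w i := P i (xi0 (t_ i \ox e0)).
have w_pure i : exists u : U, w i = u \ox e0 by apply: cyclic_pure gen.
have [u uE] := choice w_pure.
have phi_w i : (i <= k)%N -> phi0 (w i) = e0.
  move=> ik; rewrite -(reads_top_nat _ _ (PE i) (QE i)) -lmod_compE.
  rewrite [lmod_comp _ _](split_xi X0) lmod_idE QE !coef_m; [|lia|lia].
  have -> : (2 * i + 1 == 2 * i + 2)%N = false by lia.
  by rewrite eqxx scale1r scale0r addr0.
have w_shift i : (i < k)%N -> lm_act x (w i) = u i.+1 \ox lm_act x e0.
  move=> ik; rewrite -(reads_top_shift _ (PE i) (PE i.+1)) -lmod_funP pure_act.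
  rewrite (top_link ik).
  have [f fE] := lift X0 (lm_act x e0).
  have xiN : lmod_comp xi0 (tensA_hom M (fmap E f)) =
    lmod_comp (tensA_hom M (tensA_hom U (fmap E f))) xi0 := ntP xi f.
  rewrite pure_bal -[in LHS]fE -pure_map -lmod_compE xiN lmod_compE.
  by rewrite (reads_top_nat _ _ (PE i.+1) (PE i.+1)) -/(w _) uE pure_map fE.
pose b X i (v : E X) : tensA U (E X) := u i \ox v.
have bP X : chain (b X).
  split=> [i|i v ik]; first exact: pure_linr.
  have [f <-] := lift X v; rewrite /b -!pure_map -uE -lmod_funP w_shift //.
  by rewrite -lmod_funP -[in RHS]pure_map.
have bN X Y (f : hom X Y) i v :
    (fmap (compF (tensF U) E) f : lmod_hom _ _) (b X i v) =
       b Y i ((fmap E f : lmod_hom _ _) v).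
  exact: pure_map.
have [beta betaE] := string_nat (T := compF (tensF U) E) bP bN.
exists beta => X; apply: string_hom_ext => i v ik.
have [f <-] := lift X v; rewrite epsE // lmod_compE betaE // /b -pure_map -uE.
have phiN : lmod_comp (phi X) (tensA_hom U (fmap E f)) =
  lmod_comp (fmap E f) phi0 := ntP phi f.
by rewrite -lmod_compE phiN lmod_compE phi_w.
Qed.

End Strings.

(** * Equivalences of categories *)

Lemma equiv_faithful (C B : category) (E : functor C B) (X Y : C)
    (f g : hom X Y) : is_equivalence E -> fmap E f = fmap E g -> f = g.
Proof.
case=> E' [[a [a' [a'a aa']]] _] fg.
have e (h : hom X Y) : h = comp (a Y) (comp (fmap E' (fmap E h)) (a' X)).
  rewrite compA (ntP a h : comp (a Y) _ = comp h (a X)) -compA.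
  by rewrite (aa' X : comp (a X) (a' X) = idm X) compm1.
by rewrite (e f) (e g) fg.
Qed.

Lemma equiv_full (C B : category) (E : functor C B) (X Y : C)
    (h : hom (E X) (E Y)) :
  is_equivalence E -> exists f : hom X Y, fmap E f = h.
Proof.
case=> E' [isoC isoB]; have HE' : is_equivalence E' by exists E.
have [a [a' [a'a aa']]] := isoC.
exists (comp (a Y) (comp (fmap E' h) (a' X))); apply: (equiv_faithful HE').
set f := comp _ _.
have e : comp (a Y) (fmap E' (fmap E f)) = comp (a Y) (fmap E' h).
  rewrite (ntP a f : comp (a Y) _ = comp f (a X)) -!compA.
  by rewrite (a'a X : comp (a' X) (a X) = idm _) compm1.
move/(congr1 (comp (a' Y))): e; rewrite !compA.
by rewrite (a'a Y : comp (a' Y) (a Y) = idm _) !comp1m.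
Qed.

Lemma equiv_lift_nat (C B : category) (E : functor C B) (P Q : functor C C)
    (eta : forall X, hom (E (P X)) (E (Q X))) :
    is_equivalence E ->
    (forall X Y (f : hom X Y), comp (eta Y) (fmap E (fmap P f)) =
       comp (fmap E (fmap Q f)) (eta X)) ->
  exists theta : nat_trans P Q, forall X, fmap E (theta X) = eta X.
Proof.
move=> HE etaN; have thE X := cid (equiv_full (eta X) HE).
suff thN X Y (f : hom X Y) : comp (projT1 (thE Y)) (fmap P f) =
    comp (fmap Q f) (projT1 (thE X)).
  by exists (NatTrans thN) => X; apply: projT2 (thE X).
by apply: (equiv_faithful HE); rewrite !fmapM (projT2 (thE Y)) (projT2 (thE X)).
Qed.

Section RegularModule.
Variables (K : fieldType) (A : falgType K).

Definition reg_lmodule : lmodule A :=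
  @LModule K A A (fun a b => a * b) (@reg_linl K A) (@reg_linr K A) (@mul1r A)
    (fun a b c => esym (mulrA a b c)).

Lemma orbit_hom (V : lmodule A) (v : V) :
  exists f : lmod_hom reg_lmodule V, forall a, f a = lm_act a v.
Proof.
pose f : {linear A -> V} :=
  HB.pack (fun a => lm_act a v) (GRing.isLinear.Build K _ _ _ _ (lm_act_linl v)).
have fP a b : linfun f (a * b) = lm_act a (linfun f b).
  by rewrite !lfunE /= lm_actM.
by exists (@LmodHom K A reg_lmodule V (linfun f) fP) => a; exact: lfunE.
Qed.

End RegularModule.

Lemma equiv_free (K : fieldType) (C : category)
    (E : functor C (lmod_cat (dual_num K))) :
  is_equivalence E -> exists X0 e0, @free_on K C E X0 e0.
Proof.
move=> HE; have [E' [_ [b [b' [b'b bb']]]]] := HE.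
pose R := reg_lmodule (dual_num K).
pose beta : lmod_hom (E (E' R)) R := b R.
pose beta' : lmod_hom R (E (E' R)) := b' R.
have betaK v : beta' (beta v) = v.
  have := congr1 (fun f : lmod_hom _ _ => f v) (b'b R).
  by rewrite /= comp_lfunE id_lfunE.
have beta'K v : beta (beta' v) = v.
  have := congr1 (fun f : lmod_hom _ _ => f v) (bb' R).
  by rewrite /= comp_lfunE id_lfunE.
exists (E' R), (beta' 1); split=> [v|X v].
  by exists (beta v); rewrite -lmod_funP /= mulr1; exact/esym/betaK.
have [f fE] := orbit_hom v.
have [g gE] := @equiv_full _ _ E (E' R) X (lmod_comp f beta) HE.
by exists g; rewrite gE /= comp_lfunE beta'K fE lm_act1.
Qed.

(** * Splittings along an equivalence *)

Lemma square_paste (C : category) (X X' X'' Y Y' Y'' : C) (f : hom X Y)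
    (g : hom X' Y') (h : hom X'' Y'') (x1 : hom X X') (x2 : hom X' X'')
    (y1 : hom Y Y') (y2 : hom Y' Y'') :
  comp y1 f = comp g x1 -> comp y2 g = comp h x2 ->
  comp (comp y2 y1) f = comp h (comp x2 x1).
Proof. by move=> e1 e2; rewrite -compA e1 !compA e2. Qed.

Lemma square_map (C B : category) (S : functor C B) (X X' Y Y' : C)
    (f : hom X Y) (g : hom X' Y') (a : hom X X') (b : hom Y Y') :
  comp b f = comp g a ->
  comp (fmap S b) (fmap S f) = comp (fmap S g) (fmap S a).
Proof. by rewrite -!fmapM => ->. Qed.

(** [gamma] and [alpha] identify the endofunctors [F] and [G] of [C] with the
    endofunctors [S] and [T] of [B]. *)
Section Transport.
Variables (C B : category) (E : functor C B).
Hypothesis HE : is_equivalence E.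
Variables (F G : functor C C) (S T : functor B B).
Variables (gamma : nat_trans (compF E F) (compF S E)).
Variables (gamma' : nat_trans (compF S E) (compF E F)).
Variables (alpha : nat_trans (compF E G) (compF T E)).
Variables (alpha' : nat_trans (compF T E) (compF E G)).

Lemma counit_transport (eps : nat_trans (compF T E) E) :
  exists phi : nat_trans G (idF C),
    forall X, fmap E (phi X) = comp (eps X) (alpha X).
Proof.
apply: (@equiv_lift_nat _ _ E G (idF C) (fun X => comp (eps X) (alpha X)) HE).
by move=> X Y f; exact: square_paste (ntP alpha f) (ntP eps f).
Qed.

Lemma splitting_lift (eps : nat_trans (compF T E) E) (phi : nat_trans G (idF C))
    (xi : nat_trans (compF S E) (compF S (compF T E))) :
    nt_eq (vcomp gamma' gamma) (idN _) -> nt_eq (vcomp alpha alpha') (idN _) ->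
    (forall X, fmap E (phi X) = comp (eps X) (alpha X)) ->
    (forall X, comp (fmap S (eps X)) (xi X) = idm (S (E X))) ->
  exists xi' : nat_trans F (compF F G),
    nt_eq (vcomp (whisker F phi) xi') (idN F).
Proof.
move=> gK aK phiE split_xi.
pose eta X : hom (E (F X)) (E (F (G X))) :=
  comp (gamma' (G X)) (comp (fmap S (alpha' X)) (comp (xi X) (gamma X))).
have [X Y f|xi' xi'E] := @equiv_lift_nat _ _ E F (compF F G) eta HE.
  apply: square_paste (ntP gamma' (fmap G f)).
  apply: square_paste (square_map S (ntP alpha' f)).
  exact: square_paste (ntP gamma f) (ntP xi f).
exists xi' => X; apply: (equiv_faithful HE).
rewrite fmapM xi'E fmap1 /eta !compA.
rewrite -[comp (fmap E _) _](ntP gamma' (phi X)) /= phiE.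
rewrite -[comp (comp (gamma' X) _) (fmap S _)]compA -fmapM.
rewrite -[comp (comp (eps X) _) _]compA [comp (alpha X) _](aK X) compm1.
rewrite -[comp (comp (gamma' X) _) (xi X)]compA split_xi compm1.
exact: gK.
Qed.

Lemma splitting_push (phi : nat_trans G (idF C))
    (xi : nat_trans F (compF F G)) :
    nt_eq (vcomp gamma gamma') (idN _) -> nt_eq (vcomp alpha' alpha) (idN _) ->
    nt_eq (vcomp (whisker F phi) xi) (idN F) ->
  exists (eps : nat_trans (compF T E) E)
         (xi' : nat_trans (compF S E) (compF S (compF T E))),
    (forall X, eps X = comp (fmap E (phi X)) (alpha' X)) /\
    forall X, comp (fmap S (eps X)) (xi' X) = idm (S (E X)).
Proof.
move=> gK aK split_xi.
have epsN X Y (f : hom X Y) :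
    comp (comp (fmap E (phi Y)) (alpha' Y)) (fmap T (fmap E f)) =
    comp (fmap E f) (comp (fmap E (phi X)) (alpha' X)).
  exact: square_paste (ntP alpha' f) (square_map E (ntP phi f)).
pose eta X : hom (S (E X)) (S (T (E X))) :=
  comp (fmap S (alpha X)) (comp (gamma (G X)) (comp (fmap E (xi X)) (gamma' X))).
have etaN X Y (f : hom X Y) : comp (eta Y) (fmap S (fmap E f)) =
    comp (fmap S (fmap T (fmap E f))) (eta X).
  apply: square_paste (square_map S (ntP alpha f)).
  apply: square_paste (ntP gamma (fmap G f)).
  exact: square_paste (ntP gamma' f) (square_map E (ntP xi f)).
exists (NatTrans (F := compF T E) (G := E) epsN).
exists (NatTrans (F := compF S E) (G := compF S (compF T E)) etaN); split=> // X.
rewrite /= /eta fmapM -compA [comp (fmap S (alpha' X)) _]compA -fmapM.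
rewrite [comp (alpha' X) _](aK X) fmap1 comp1m compA.
rewrite -[comp (fmap S _) _](ntP gamma (phi X)) -compA.
rewrite [comp (fmap (compF E F) _) _]compA -fmapM.
by rewrite [comp (fmap F _) _](split_xi X) fmap1 comp1m; apply: gK.
Qed.

End Transport.

(** * The string bimodule is great *)

Theorem proposition14 (K : closedFieldType)
    (charK : [pchar K]%R =i pred0)
    (C : category) (E : functor C (lmod_cat (dual_num K)))
    (HE : is_equivalence E)
    (m k : nat) (k_ge1 : (1 <= k)%N) (k_le_m : (k <= m)%N)
    (G : functor C C) (HG : is_tensor E (M_ K k) G) :
  great (trunc_mor E m) (cell_NM E k) G.
Proof.
have [alpha [alpha' [alphaK alphaK']]] := HG.
have idP : bimod_mor (\1%VF : 'Hom(M_ K k, M_ K k)).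
  by split=> a u; rewrite !id_lfunE.
split.
  exists (M_ K k) => //; apply/add_gen/Or32; exists k => //.
  case: k k_ge1 {k_le_m HG alpha alpha' alphaK alphaK'} idP => // k _ idP.
  constructor 4; exists \1%VF => //.
  by exists id => u; rewrite id_lfunE.
have [eps epsE] := counit_exists k_ge1 E.
have [phi phiE] := counit_transport HE alpha eps.
have [X0 [e0 e0P]] := equiv_free HE.
have good (F : bimodule (dual_num K)) (p : 'Hom(M_ K k, F)) s (H : functor C C) :
    bimod_mor p -> cancel s p ->
    (forall u, p u = 0 -> u \in <[m_ K k (2 * k + 3) : M_ K k]>%VS) ->
    is_tensor E F H -> exists xi : nat_trans H (compF H G),
      nt_eq (vcomp (whisker H phi) xi) (idN H).
  move=> pP sK kerp [gamma [gamma' [gammaK _]]].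
  have [xi xiE] := diagonal_exists k_ge1 pP sK kerp epsE.
  exact: (@splitting_lift _ _ E HE H G (tensF F) _ _ _ _ _ _ _ xi
    gammaK alphaK' phiE xiE).
exists phi; split=> [H [HN|HM]|G' phi' [U _ HU] good'].
- have qE u : linfun (qproj <[m_ K k (2 * k + 3) : M_ K k]>) u = qproj _ u.
    exact: lfunE.
  apply: (good (N_ K k) (linfun (qproj _)) (@qlift _ _ _)) HN.
  + exact: qproj_mor.
  + by move=> t; exact: etrans (qE _) (qliftK t).
  + by move=> u; rewrite qE => /eqP; rewrite qproj_eq0.
- have idK : cancel id (\1%VF : 'Hom(M_ K k, M_ K k)).
    by move=> u; rewrite id_lfunE.
  apply: (good _ _ _ _ idP idK _ HM) => u.
  by rewrite id_lfunE => ->; apply: mem0v.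
(* Goodness of [G'] is used for [G] itself, as a member of the left cell. *)
have [xi xiE] := good' G (or_intror HG).
have [delta [delta' [deltaK deltaK']]] := HU.
have [eps' [xi' [eps'E split_xi']]] :=
  splitting_push alphaK' deltaK xiE.
have [beta betaE] := counit_represents k_ge1 e0P epsE split_xi'.
have [X Y f|beta' beta'E] := @equiv_lift_nat _ _ E G G'
  (fun X => comp (delta' X) (comp (beta X) (alpha X))) HE.
  apply: square_paste (ntP delta' f).
  exact: square_paste (ntP alpha f) (ntP beta f).
exists beta' => X; apply: (equiv_faithful HE).
rewrite fmapM phiE beta'E betaE -[vcomp _ _ X]/(comp (eps' X) (beta X)) eps'E.
by rewrite !compA.
Qed.
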